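(* Let $Q$ be a discrete memoryless channel (in the asynchronous communication model described in the context). Suppose that for some constants $\alpha\ge 0$, $t_1\ge 0$, $t_2>1$, and some input distribution $P$ on $\mathcal X$ with $I(PQ)>0$, the inequalities $$\text{(a)}\quad \alpha<\inf_{\substack{V\in\mathcal P^{\mathcal Y|\mathcal X}\\ D((PV)_Y\|Q(\cdot|\star))<\frac{t_1\alpha}{\delta(t_1+t_2-1)}}} D\big((PV)_Y\,\|\,(PQ)_Y\big),$$ $$\text{(b)}\quad \alpha<\min_{\substack{V\in\mathcal P^{\mathcal Y|\mathcal X}\\ I(PV)\le \frac{t_2\alpha}{\delta(t_1+t_2-1)}}} D(PV\|PQ),$$ $$\text{(c)}\quad \frac{t_1}{t_2}<\frac{D((PQ)_Y\|Q(\cdot|\star))}{I(PQ)}$$ hold for some $\delta\in(0,1)$. Then the asynchronism exponent $\alpha$ is achievable at rate $I(PQ)/t_2$.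
   Context: Model. A discrete memoryless channel has finite input alphabet $\mathcal X$, finite output alphabet $\mathcal Y$, transition probabilities $Q(y|x)$, and a distinguished ''noise'' input symbol $\star\in\mathcal X$. Standing assumptions: for every $y\in\mathcal Y$ there is $x$ with $Q(y|x)>0$, and the capacity $C(Q)$ of the synchronized channel is strictly positive. A code consists of $M\ge 2$ equally likely messages, codewords $c^N(m)\in\mathcal X^N$, and a sequential decoder. The asynchronism level is an integer $A\ge1$: the start time $\nu$ is uniform on $\{1,\dots,A\}$, independent of the message. Given message $m$ and $\nu$, outputs $Y_1,Y_2,\dots$ are independent with $Y_i\sim Q(\cdot|\star)$ if $i\le\nu-1$ or $i\ge\nu+N$, and $Y_i\sim Q(\cdot|c_{i-\nu+1}(m))$ for $\nu\le i\le\nu+N-1$. The receiver knows $A$ and the code but not $\nu$. A decoder is $(\tau,\phi)$ with $\tau$ a stopping time w.r.t. $Y_1,Y_2,\dots$ and $\phi$ a function of $Y_1,\dots,Y_\tau$ returning a message. With $\mathbb P_{m,l},\mathbb E_{m,l}$ conditioning on message $m$ and $\nu=l$: $\mathbb P(\mathcal E)=\frac1{AM}\sum_{m,l}\mathbb P_{m,l}(\phi\neq m)$, $\mathbb E(\tau-\nu)^+=\frac1{AM}\sum_{m,l}\mathbb E_{m,l}(\tau-l)^+$, rate $R=\ln M/\mathbb E(\tau-\nu)^+$. An asynchronism exponent $\alpha$ is achievable at rate $R$ if for every $\varepsilon>0$ there is a code with (sufficiently large) blocklength $N$ operating at asynchronism level $A=e^{(\alpha-\varepsilon)N}$ with rate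 at least $R-\varepsilon$ and $\mathbb P(\mathcal E)\le\varepsilon$. Notation. $\mathcal P^{\mathcal Y|\mathcal X}$ is the set of conditional distributions $V(y|x)$. For a distribution $P$ on $\mathcal X$ and $V\in\mathcal P^{\mathcal Y|\mathcal X}$, $PV$ denotes the joint distribution $P(x)V(y|x)$ on $\mathcal X\times\mathcal Y$ and $(PV)_Y$ its $\mathcal Y$-marginal. For a joint distribution $J$, $I(J)$ is the mutual information induced by $J$. $D$ is Kullback–Leibler divergence (natural logs). An infimum over an empty set is $+\infty$. *)

(* Defs.v *)
From HB Require Import structures.
From mathcomp Require Import all_boot all_order all_algebra.
From mathcomp Require Import all_classical all_reals all_analysis.
Set Implicit Arguments. Unset Strict Implicit. Unset Printing Implicit Defensive.
Import Order.TTheory GRing.Theory Num.Theory.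
Local Open Scope ring_scope.
Local Open Scope classical_set_scope.

Section InfoDefs.
Variable R : realType.

Definition is_dist (T : finType) (p : T -> R) : Prop :=
  (forall t, 0 <= p t) /\ \sum_t p t = 1.

Definition is_chan (X Y : finType) (V : X -> Y -> R) : Prop :=
  forall x, is_dist (V x).

(* Kullback-Leibler divergence (natural log), with 0 ln(0/q) = 0 and
   p ln(p/0) = +oo for p > 0. *)
Definition divKL (T : finType) (p q : T -> R) : \bar R :=
  if [exists t, (0 < p t) && (q t == 0)] then +oo%E
  else (\sum_(t | 0 < p t) p t * ln (p t / q t))%:E.

Definition joint (X Y : finType) (P : X -> R) (V : X -> Y -> R) : X * Y -> R :=
  fun z => P z.1 * V z.1 z.2.

Definition outm (X Y : finType) (P : X -> R) (V : X -> Y -> R) : Y -> R :=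
  fun y => \sum_x P x * V x y.

Definition mutinf (X Y : finType) (J : X * Y -> R) : R :=
  \sum_(z | 0 < J z)
     J z * ln (J z / ((\sum_y J (z.1, y)) * (\sum_x J (x, z.2)))).

Definition capacity (X Y : finType) (Q : X -> Y -> R) : \bar R :=
  ereal_sup [set (mutinf (joint P Q))%:E | P in [set P | is_dist P]].

Variables (X Y : finType) (Q : X -> Y -> R) (star : X).

(* Input symbol at (1-indexed) time i, for message m and start time l:
   the codeword symbol c_{i-l+1}(m) if l <= i <= l+N-1, else star. *)
Definition inp (M N : nat) (c : 'I_M -> 'I_N -> X) (m : 'I_M) (l i : nat) : X :=
  if ((l <= i) && (i < l + N))%N then
    (if insub (i - l)%N is Some k then c m k else star)
  else star.

Definition pref_prob (M N : nat) (c : 'I_M -> 'I_N -> X) (m : 'I_M) (l n : nat)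
    (t : n.-tuple Y) : R :=
  \prod_(i < n) Q (inp c m l i.+1) (tnth t i).

(* A stopping time is given by a stopping rule on observed prefixes:
   tau = n iff the rule fires on Y_1..Y_n and on no shorter prefix. *)
Definition first_stop (stop : seq Y -> bool) (ys : seq Y) : bool :=
  stop ys && [forall k : 'I_(size ys), ~~ stop (take k ys)].

Definition p_tau (M N : nat) (c : 'I_M -> 'I_N -> X) (stop : seq Y -> bool)
    (m : 'I_M) (l n : nat) : R :=
  \sum_(t : n.-tuple Y | first_stop stop t) pref_prob c m l t.

Definition p_tau_dec (M N : nat) (c : 'I_M -> 'I_N -> X) (stop : seq Y -> bool)
    (dec : seq Y -> 'I_M) (m : 'I_M) (l n : nat) (m' : 'I_M) : R :=
  \sum_(t : n.-tuple Y | first_stop stop t && (dec t == m')) pref_prob c m l t.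

Local Open Scope ereal_scope.

(* P_{m,l}(phi <> m); on {tau = oo} no message is decoded: counted as error *)
Definition p_err_ml (M N : nat) (c : 'I_M -> 'I_N -> X) (stop : seq Y -> bool)
    (dec : seq Y -> 'I_M) (m : 'I_M) (l : nat) : \bar R :=
  1 - \sum_(n <oo) (p_tau_dec c stop dec m l n m)%:E.

(* E_{m,l}(tau - l)^+ ; on {tau = oo} the delay is +oo *)
Definition delay_ml (M N : nat) (c : 'I_M -> 'I_N -> X) (stop : seq Y -> bool)
    (m : 'I_M) (l : nat) : \bar R :=
  \sum_(n <oo) (((n - l)%N)%:R * p_tau c stop m l n)%:E
  + (if \sum_(n <oo) (p_tau c stop m l n)%:E < 1 then +oo else 0).

(* P(E), average over messages and uniform nu in {1..A} *)
Definition p_err (A M N : nat) (c : 'I_M -> 'I_N -> X) (stop : seq Y -> bool)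
    (dec : seq Y -> 'I_M) : \bar R :=
  ((A * M)%:R^-1)%:E * \sum_(m < M) \sum_(1 <= l < A.+1) p_err_ml c stop dec m l.

Definition delay (A M N : nat) (c : 'I_M -> 'I_N -> X) (stop : seq Y -> bool)
  : \bar R :=
  ((A * M)%:R^-1)%:E * \sum_(m < M) \sum_(1 <= l < A.+1) delay_ml c stop m l.

(* rate ln M / E(tau - nu)^+, as an extended real
   (ln M / +oo = 0, ln M / 0 = +oo since M >= 2) *)
Definition rate (A M N : nat) (c : 'I_M -> 'I_N -> X) (stop : seq Y -> bool)
  : \bar R :=
  let E := delay A c stop in
  if E == +oo then 0
  else if fine E == 0%R then +oo
  else (ln (M%:R) / fine E)%:E.

Local Close Scope ereal_scope.

Definition achievable (alpha Rt : R) : Prop :=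
  forall eps : R, 0 < eps ->
  exists N0 : nat, forall N : nat, (N0 <= N)%N -> (0 < N)%N ->
  exists (M A : nat) (c : 'I_M -> 'I_N -> X) (stop : seq Y -> bool)
         (dec : seq Y -> 'I_M),
    [/\ (2 <= M)%N, (1 <= A)%N,
        (A%:R : R) = (Num.ceil (expR ((alpha - eps) * N%:R)))%:~R,
        ((Rt - eps)%:E <= rate A c stop)%E &
        (p_err A c stop dec <= eps%:E)%E].

End InfoDefs.

(* Main.v *)
(* Random coding with a sequential decoder. At every time [n] and for every window length
   [k <= N], the receiver compares the last [k] outputs with the first [k] symbols of each
   codeword: it stops when these outputs differ from the noise law, [k D(type || Q(.|star)) >= t1 L],
   and have empirical mutual information [>= t2 L / k] with a codeword, where [L = ln M]
   up to rounding; it stops at time [A + N] at the latest.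

   - False alarms. A wrong codeword is independent of the outputs, so by the method of types
     it passes with probability [e^(- t2 L)], and with [e^(- (t1 + t2) L)] on pure noise, up
     to polynomial factors. A union bound over about [A N M] such events suffices when
     [(t1 + t2 - 1) L = alpha N]. Early stopping on the sent message is harmless, since
     only [(tau - nu)^+] counts.
   - Delay. By Chebyshev's inequality and (c), the sent codeword passes after about
     [t2 L / I(PQ)] symbols with probability [1 - O(1/N)], and always after at most [A + N].
     The latter is compensated by the probability of failing at the full length [N], which is
     exponentially smaller than [1/A]: by (a) for the noise test, because the outputs have law
     [(PQ)_Y] when averaged over i.i.d. codewords, and by (b) for the second test, for
     codewords whose type is at least [w P] with [w < 1] close to [1]. Conditioning i.i.d.
     codewords on this event at most doubles their probabilities. *)
Require Import Defs.
From HB Require Import structures.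
From mathcomp Require Import all_boot all_order all_algebra.
From mathcomp Require Import all_classical all_reals all_analysis.
From mathcomp Require Import ring lra zify.
Set Implicit Arguments. Unset Strict Implicit. Unset Printing Implicit Defensive.
Import Order.TTheory GRing.Theory Num.Theory.
Local Open Scope ring_scope.
Local Open Scope classical_set_scope.

(** * Product measures on finite functions *)

Section ProductMeasure.
Variables (R : realType).
Implicit Types (I J T D : finType).

Lemma sum_prod_ffun I T (f : I -> T -> R) :
  \sum_(t : {ffun I -> T}) \prod_i f i (t i) = \prod_i \sum_b f i b.
Proof. by rewrite bigA_distr_bigA. Qed.

Lemma sum_prod_at I T (f : I -> T -> R) (i0 : I) (g : T -> R) :
  \sum_(t : {ffun I -> T}) (\prod_i f i (t i)) * g (t i0) =
  (\prod_(i | i != i0) \sum_b f i b) * \sum_b f i0 b * g b.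
Proof.
pose f' i b := f i b * (if i == i0 then g b else 1).
transitivity (\sum_(t : {ffun I -> T}) \prod_i f' i (t i)).
  apply: eq_bigr => t _; rewrite /f' big_split /=; congr (_ * _).
  rewrite (bigD1 i0) //= eqxx big1 ?mulr1 // => i /negbTE ->; by [].
rewrite sum_prod_ffun (bigD1 i0) //= mulrC; congr (_ * _).
  by apply: eq_bigr => i /negbTE ii0; apply: eq_bigr => b _; rewrite /f' ii0 mulr1.
by apply: eq_bigr => b _; rewrite /f' eqxx.
Qed.

Lemma sum_prod_marg1 I T (f : I -> T -> R) (i0 : I) (g : T -> R) :
  (forall i, \sum_b f i b = 1) ->
  \sum_(t : {ffun I -> T}) (\prod_i f i (t i)) * g (t i0) = \sum_b f i0 b * g b.
Proof. by move=> f1; rewrite sum_prod_at big1 ?mul1r. Qed.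

(** Inserting the indicator that coordinate [i0] equals [a] keeps the weight in product form for
    each fixed [a], so the one-coordinate identity applies to [i1]. *)
Lemma sum_prod_marg2 I T (f : I -> T -> R) (i0 i1 : I) (G : T -> T -> R) :
  (forall i, \sum_b f i b = 1) -> i0 != i1 ->
  \sum_(t : {ffun I -> T}) (\prod_i f i (t i)) * G (t i0) (t i1) =
  \sum_a f i0 a * \sum_b f i1 b * G a b.
Proof.
move=> f1 i01.
pose f' a i b := f i b * (if i == i0 then (b == a)%:R else 1).
transitivity (\sum_a \sum_(t : {ffun I -> T}) (\prod_i f' a i (t i)) * G a (t i1)).
  rewrite exchange_big /=; apply: eq_bigr => t _.
  rewrite (bigD1 (t i0)) //= [X in _ = _ + X]big1 ?addr0.
    congr (_ * _); rewrite /f' big_split /= [X in _ = _ * X]big1 ?mulr1 // => i _.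
    by case: eqP => [->|//]; rewrite eqxx.
  move=> a ta; rewrite (bigD1 i0) //= /f' !eqxx.
  by rewrite eq_sym (negbTE ta) mulr0 !mul0r.
apply: eq_bigr => a _; rewrite sum_prod_at (bigD1 i0) //=.
rewrite [X in _ * X * _]big1 ?mulr1; last first.
  by move=> i /andP[_ /negbTE ii0]; rewrite -(f1 i); apply: eq_bigr => b _; rewrite /f' ii0 mulr1.
congr (_ * _).
  rewrite (bigD1 a) //= /f' !eqxx mulr1 big1 ?addr0 // => b /negbTE ->.
  by rewrite mulr0.
by apply: eq_bigr => b _; rewrite /f' eq_sym (negbTE i01) mulr1.
Qed.

Lemma sum_prod_marg I J T (f : I -> T -> R) (e : J -> I) (g : {ffun J -> T} -> R) :
  (forall i, \sum_b f i b = 1) -> injective e ->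
  \sum_(t : {ffun I -> T}) (\prod_i f i (t i)) * g [ffun j => t (e j)] =
  \sum_(s : {ffun J -> T}) (\prod_j f (e j) (s j)) * g s.
Proof.
move=> f1 einj.
rewrite (partition_big (fun t : {ffun I -> T} => [ffun j => t (e j)]) xpredT) //=.
apply: eq_bigr => s _.
(* Fixing the restriction of [t] along [e] is a coordinatewise constraint: coordinates in the image
   of [e] are pinned, the others are free and sum to 1. *)
pose F i := [pred b : T | [forall j, (e j == i) ==> (b == s j)]].
rewrite (eq_bigr (fun t : {ffun I -> T} => (\prod_i f i (t i)) * g s)); last first.
  by move=> t /eqP ->.
rewrite -big_distrl /=; congr (_ * _).
transitivity (\sum_(t in family F) \prod_i f i (t i)).
  apply: eq_bigl => t; apply/eqP/familyP => [ts i|H].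
    by apply/forallP => j; apply/implyP => /eqP <-; rewrite -ts ffunE.
  apply/ffunP => j; rewrite ffunE; have := H (e j); rewrite inE => /forallP /(_ j).
  by rewrite eqxx => /eqP.
rewrite -bigA_distr_big_dep.
rewrite (bigID (mem (codom e))) /= [X in _ * X]big1 ?mulr1; last first.
  move=> i /negP ie; rewrite -(f1 i); apply: eq_bigl => b /=.
  apply/forallP => j; apply/implyP => /eqP ej; case: ie; rewrite -ej; exact: codom_f.
rewrite -big_uniq /=; last by rewrite map_inj_uniq // enum_uniq.
rewrite big_image /=; apply: eq_bigr => j _.
rewrite (big_pred1 (s j)) // => b /=.
apply/forallP/eqP => [/(_ j)|-> j']; first by rewrite eqxx => /eqP.
by apply/implyP => /eqP /einj ->.
Qed.

(** The counting step of the method of types: the term of the class of [t] is bounded by the sum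
    over all classes, and each fixed class has total mass at most 1. *)
Lemma sum_prod_le_card I T D (ty : {ffun I -> T} -> D) (K : D -> I -> T -> R) :
  (forall d i b, 0 <= K d i b) -> (forall d i, \sum_b K d i b <= 1) ->
  \sum_(t : {ffun I -> T}) \prod_i K (ty t) i (t i) <= #|D|%:R.
Proof.
move=> K0 K1.
apply: (@le_trans _ _ (\sum_(d : D) \sum_(t : {ffun I -> T}) \prod_i K d i (t i))).
  rewrite exchange_big /=; apply: ler_sum => t _.
  by rewrite (bigD1 (ty t)) //= lerDl; apply: sumr_ge0 => d _; apply: prodr_ge0.
rewrite -sum1_card natr_sum; apply: ler_sum => d _.
rewrite sum_prod_ffun; apply: Num.Theory.prodr_ile1 => i _.
by rewrite K1 andbT; apply: sumr_ge0.
Qed.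

Lemma sum_pair_ffun I (S T : finType) (F : {ffun I -> S} -> {ffun I -> T} -> R) :
  \sum_x \sum_z F x z =
  \sum_(w : {ffun I -> S * T}) F [ffun i => (w i).1] [ffun i => (w i).2].
Proof.
rewrite pair_big /= [RHS](reindex
  (fun p : {ffun I -> S} * {ffun I -> T} => [ffun i => (p.1 i, p.2 i)])) /=.
  apply: eq_bigr => -[x z] _ /=; congr F; apply/ffunP => i; by rewrite !ffunE.
exists (fun w : {ffun I -> S * T} => ([ffun i => (w i).1], [ffun i => (w i).2])).
  by move=> [x z] _; congr pair; apply/ffunP => i; rewrite !ffunE.
by move=> w _; apply/ffunP => i; rewrite !ffunE; case: (w i).
Qed.

Lemma chebyshev_prod k T (p f : T -> R) (mu eta : R) :
  is_dist p -> 0 < eta -> (0 < k)%N -> mu = \sum_b p b * f b ->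
  \sum_(t : {ffun 'I_k -> T} | eta * k%:R <= `| \sum_i f (t i) - k%:R * mu |)
     \prod_i p (t i)
  <= (\sum_b p b * (f b - mu) ^+ 2) / (eta ^+ 2 * k%:R).
Proof.
move=> [p0 p1] eta0 k0 muE.
have ck0 : 0 < k%:R :> R by rewrite ltr0n.
pose g b := f b - mu.
have g0 : \sum_b p b * g b = 0.
  by under eq_bigr do rewrite mulrBr; rewrite sumrB -mulr_suml p1 mul1r -muE subrr.
have var : \sum_(t : {ffun 'I_k -> T}) (\prod_i p (t i)) * (\sum_i g (t i)) ^+ 2
    = k%:R * \sum_b p b * g b ^+ 2.
  transitivity (\sum_(i < k) \sum_(j < k) \sum_(t : {ffun 'I_k -> T})
      (\prod_i p (t i)) * (g (t i) * g (t j))).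
    under [RHS]eq_bigr do rewrite exchange_big /=.
    rewrite [RHS]exchange_big /=; apply: eq_bigr => t _.
    rewrite expr2 mulr_suml mulr_sumr; apply: eq_bigr => i _.
    by rewrite mulr_sumr mulr_sumr.
  (* By independence and centering, the off-diagonal terms vanish. *)
  rewrite (eq_bigr (fun=> \sum_b p b * g b ^+ 2)); last first.
    move=> i _; rewrite (bigD1 i) //= [X in _ + X = _]big1 ?addr0.
      under [RHS]eq_bigr do rewrite expr2.
      exact: (@sum_prod_marg1 _ _ (fun=> p) i (fun b => g b * g b) (fun=> p1)).
    move=> j ji.
    have /= -> := @sum_prod_marg2 _ _ (fun=> p) i j (fun a b => g a * g b) (fun=> p1).
      apply: big1 => a _; rewrite (eq_bigr (fun b => g a * (p b * g b))).
        by rewrite -mulr_sumr g0 !mulr0.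
      by move=> b _; rewrite mulrCA.
    by rewrite eq_sym.
  by rewrite sumr_const card_ord mulr_natl.
have -> : (\sum_b p b * (f b - mu) ^+ 2) / (eta ^+ 2 * k%:R) =
    (k%:R * \sum_b p b * g b ^+ 2) / (eta * k%:R) ^+ 2.
  by field; rewrite !gt_eqF.
rewrite -var ler_pdivlMr ?exprn_gt0 ?mulr_gt0 //.
rewrite mulr_suml big_mkcond /=; apply: ler_sum => t _.
have pt0 : 0 <= \prod_i p (t i) by apply: prodr_ge0.
case: ifP => [le_dev|_]; last by rewrite mulr_ge0 // sqr_ge0.
apply: ler_wpM2l => //.
have -> : \sum_i g (t i) = \sum_i f (t i) - k%:R * mu.
  by rewrite sumrB sumr_const card_ord mulr_natl.
rewrite -[leRHS]real_normK ?num_real //.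
by rewrite ler_sqr ?nnegrE // ltW // mulr_gt0.
Qed.

End ProductMeasure.

(** * Types *)

Section Types.
Variables (R : realType).
Implicit Types (T X Y : finType).

Definition cnt k T (z : {ffun 'I_k -> T}) (t : T) : nat := \sum_(i < k) (z i == t).

(** The type of [z] in the sense of the method of types; joint types are types of zipped
    sequences. *)
Definition emp k T (z : {ffun 'I_k -> T}) (t : T) : R := (cnt z t)%:R / k%:R.

Definition zipf k X Y (x : {ffun 'I_k -> X}) (z : {ffun 'I_k -> Y}) :
  {ffun 'I_k -> X * Y} := [ffun i => (x i, z i)].

Lemma cnt_le k T (z : {ffun 'I_k -> T}) t : (cnt z t <= k)%N.
Proof.
rewrite -[leqRHS]card_ord -sum1_card; apply: leq_sum => i _; exact: leq_b1.
Qed.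

Lemma cnt_gt0 k T (z : {ffun 'I_k -> T}) i : (0 < cnt z (z i))%N.
Proof. by rewrite /cnt (bigD1 i) //= eqxx. Qed.

Lemma cnt_gt0_ex k T (z : {ffun 'I_k -> T}) t : (0 < cnt z t)%N -> exists i, z i = t.
Proof.
rewrite lt0n sum_nat_eq0 negb_forall => /existsP[i].
by rewrite /= eqb0 negbK => /eqP <-; exists i.
Qed.

Lemma sum_cntE k T (z : {ffun 'I_k -> T}) (f : T -> R) :
  \sum_i f (z i) = \sum_t (cnt z t)%:R * f t.
Proof.
under [RHS]eq_bigr do rewrite natr_sum mulr_suml.
rewrite exchange_big /=; apply: eq_bigr => i _.
rewrite (bigD1 (z i)) //= eqxx mul1r big1 ?addr0 // => t.
by rewrite eq_sym => /negbTE ->; rewrite mul0r.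
Qed.

Lemma sum_cnt k T (z : {ffun 'I_k -> T}) : \sum_t (cnt z t)%:R = k%:R :> R.
Proof.
have := sum_cntE z (fun=> 1); rewrite sumr_const card_ord => ->.
by apply: eq_bigr => t _; rewrite mulr1.
Qed.

Lemma cnt_zipl k X Y (x : {ffun 'I_k -> X}) (z : {ffun 'I_k -> Y}) a :
  \sum_b (cnt (zipf x z) (a, b))%:R = (cnt x a)%:R :> R.
Proof.
rewrite -natr_sum; congr (_%:R); rewrite exchange_big /=; apply: eq_bigr => i _.
rewrite (bigD1 (z i)) //= ffunE xpair_eqE eqxx andbT big1 ?addn0 // => b.
by rewrite xpair_eqE eq_sym => /negbTE ->; rewrite andbF.
Qed.

Lemma cnt_zipr k X Y (x : {ffun 'I_k -> X}) (z : {ffun 'I_k -> Y}) b :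
  \sum_a (cnt (zipf x z) (a, b))%:R = (cnt z b)%:R :> R.
Proof.
rewrite -natr_sum; congr (_%:R); rewrite exchange_big /=; apply: eq_bigr => i _.
rewrite (bigD1 (x i)) //= ffunE xpair_eqE eqxx /= big1 ?addn0 // => a.
by rewrite xpair_eqE eq_sym => /negbTE ->.
Qed.

Lemma emp_ge0 k T (z : {ffun 'I_k -> T}) t : 0 <= emp z t.
Proof. by rewrite /emp divr_ge0. Qed.

Lemma emp_dist k T (z : {ffun 'I_k -> T}) : (0 < k)%N -> is_dist (emp z).
Proof.
move=> k0; split => [t|]; first exact: emp_ge0.
by rewrite -mulr_suml sum_cnt divff // pnatr_eq0 -lt0n.
Qed.

(** Maximum likelihood property of the type. By AM-GM the product of the ratios [q / emp] is at most
    the [k]-th power of their mean, and that mean is the [q]-mass of the letters occurring in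
    [z]. *)
Lemma prod_le_emp k T (z : {ffun 'I_k -> T}) (q : T -> R) :
  (forall t, 0 <= q t) -> \sum_t q t <= 1 ->
  \prod_i q (z i) <= \prod_i emp z (z i).
Proof.
move=> q0 q1; case: (posnP k) => [k0|k0].
  by move: z; rewrite k0 => z; rewrite !big_ord0.
have k0' : 0 < k%:R :> R by rewrite ltr0n.
have e0 i : 0 < emp z (z i) by rewrite divr_gt0 // ltr0n cnt_gt0.
pose a i := q (z i) / emp z (z i).
have -> : \prod_i q (z i) = \prod_i a i * \prod_i emp z (z i).
  rewrite -big_split; apply: eq_bigr => i _ /=; by rewrite /a divfK // gt_eqF.
rewrite ler_piMl //; first by apply: prodr_ge0 => i _; rewrite ltW.
have a0 i : 0 <= a i by rewrite divr_ge0 // ltW.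
have := leif_AGM (E := a) (A := [pred i : 'I_k | true]) (fun i _ => a0 i).
case=> + _; rewrite card_ord => /le_trans; apply.
apply: exprn_ile1; first by rewrite divr_ge0 // sumr_ge0.
rewrite ler_pdivrMr // mul1r /a (sum_cntE z (fun t => q t / emp z t)).
apply: (@le_trans _ _ (\sum_t k%:R * q t)); last by rewrite -mulr_sumr ler_piMr.
apply: ler_sum => t _; case: (posnP (cnt z t)) => [->|c0].
  by rewrite mul0r mulr_ge0.
have c0' : 0 < (cnt z t)%:R :> R by rewrite ltr0n.
rewrite /emp le_eqVlt; apply/orP; left; apply/eqP.
by field; rewrite !gt_eqF.
Qed.

(** Types are encoded in a finite type with [(k+1)^|T|] elements, which bounds their number. *)
Definition typ k T (z : {ffun 'I_k -> T}) : {ffun T -> 'I_k.+1} :=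
  [ffun t => inord (cnt z t)].

Lemma typE k T (z : {ffun 'I_k -> T}) t : typ z t = cnt z t :> nat.
Proof. by rewrite ffunE inordK // ltnS cnt_le. Qed.

Lemma sum_prod_emp_le k T :
  \sum_(z : {ffun 'I_k -> T}) \prod_i emp z (z i) <= (k.+1 ^ #|T|)%:R.
Proof.
(* Normalising by the total count makes [K d] a subprobability even when [d] is not the type of any
   sequence. *)
pose K (d : {ffun T -> 'I_k.+1}) (i : 'I_k) (b : T) : R :=
  (d b)%:R / \sum_b' (d b')%:R.
rewrite -[X in (X ^ _)%N]card_ord -card_ffun.
apply: le_trans (@sum_prod_le_card _ _ _ _ (@typ k T) K _ _).
- apply: ler_sum => z _; apply: ler_prod => i _; rewrite emp_ge0 /K typE.
  by rewrite (eq_bigr (fun b => (cnt z b)%:R)) ?sum_cnt //= => b _; rewrite typE.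
- by move=> d i b; rewrite divr_ge0 // sumr_ge0.
- move=> d i; rewrite -mulr_suml.
  have [->|s0] := eqVneq (\sum_b (d b)%:R : R) 0; first by rewrite mul0r.
  by rewrite divff.
Qed.

(** For fixed joint counts, the conditional law of the inputs given [z] is a product over positions,
    so its maximised version sums to at most the number of joint types. *)
Lemma sum_prod_condl_le k X Y (z : {ffun 'I_k -> Y}) :
  \sum_(x : {ffun 'I_k -> X})
    \prod_i ((cnt (zipf x z) (x i, z i))%:R / (cnt z (z i))%:R)
  <= (k.+1 ^ (#|X| * #|Y|))%:R :> R.
Proof.
pose K (d : {ffun X * Y -> 'I_k.+1}) (i : 'I_k) (a : X) : R :=
  (d (a, z i))%:R / \sum_a' (d (a', z i))%:R.
rewrite -[X in (X ^ _)%N]card_ord -card_prod -card_ffun.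
apply: le_trans (@sum_prod_le_card _ _ _ _ (fun x => typ (zipf x z)) K _ _).
- apply: ler_sum => x _; apply: ler_prod => i _; rewrite divr_ge0 //= /K typE.
  rewrite -(cnt_zipr x z (z i)) le_eqVlt; apply/orP; left; apply/eqP.
  by congr (_ / _); apply: eq_bigr => a _; rewrite typE.
- by move=> d i b; rewrite divr_ge0 // sumr_ge0.
- move=> d i; rewrite -mulr_suml.
  have [->|s0] := eqVneq (\sum_a (d (a, z i))%:R : R) 0; first by rewrite mul0r.
  by rewrite divff.
Qed.

Lemma sum_prod_condr_le k X Y (x : {ffun 'I_k -> X}) :
  \sum_(z : {ffun 'I_k -> Y})
    \prod_i ((cnt (zipf x z) (x i, z i))%:R / (cnt x (x i))%:R)
  <= (k.+1 ^ (#|X| * #|Y|))%:R :> R.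
Proof.
pose K (d : {ffun X * Y -> 'I_k.+1}) (i : 'I_k) (b : Y) : R :=
  (d (x i, b))%:R / \sum_b' (d (x i, b'))%:R.
rewrite -[X in (X ^ _)%N]card_ord -card_prod -card_ffun.
apply: le_trans (@sum_prod_le_card _ _ _ _ (fun z => typ (zipf x z)) K _ _).
- apply: ler_sum => z _; apply: ler_prod => i _; rewrite divr_ge0 //= /K typE.
  rewrite -(cnt_zipl x z (x i)) le_eqVlt; apply/orP; left; apply/eqP.
  by congr (_ / _); apply: eq_bigr => a _; rewrite typE.
- by move=> d i b; rewrite divr_ge0 // sumr_ge0.
- move=> d i; rewrite -mulr_suml.
  have [->|s0] := eqVneq (\sum_b (d (x i, b))%:R : R) 0; first by rewrite mul0r.
  by rewrite divff.
Qed.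

Lemma prod_le_exp_ln (I : finType) (a b : I -> R) (tau : R) :
  (forall i, 0 < a i) -> (forall i, 0 < b i) ->
  tau <= \sum_i ln (b i / a i) ->
  \prod_i a i <= expR (- tau) * \prod_i b i.
Proof.
move=> a0 b0 htau.
have -> : \prod_i b i = expR (\sum_i ln (b i / a i)) * \prod_i a i.
  rewrite expR_sum -big_split; apply: eq_bigr => i _ /=.
  by rewrite lnK ?posrE ?divr_gt0 // divfK // gt_eqF.
rewrite mulrA -expRD ler_peMl //; last by rewrite -expR0 ler_expR; lra.
by apply: prodr_ge0 => i _; rewrite ltW.
Qed.

(** Real-valued divergence. It agrees with [divKL] only under absolute continuity: a letter with
    [q t = 0] contributes 0 here, by the conventions for division and [ln] at 0. *)
Definition kl T (p q : T -> R) : R := \sum_t p t * ln (p t / q t).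

Lemma divKL_klE T (p q : T -> R) : (forall t, 0 <= p t) ->
  (forall t, 0 < p t -> q t != 0) -> divKL p q = (kl p q)%:E.
Proof.
move=> p0 ac; rewrite /divKL; case: ifPn => [/existsP[t /andP[pt /eqP qt]]|_].
  by move: (ac t pt); rewrite qt eqxx.
congr (_%:E); rewrite /kl big_mkcond /=; apply: eq_bigr => t _.
case: ifPn => //; rewrite lt_neqAle p0 andbT negbK => /eqP <-; by rewrite mul0r.
Qed.

Lemma kl_ge0 T (p q : T -> R) : (forall t, 0 <= p t) -> (forall t, 0 <= q t) ->
  (forall t, 0 < p t -> q t != 0) -> \sum_t q t <= \sum_t p t -> 0 <= kl p q.
Proof.
move=> p0 q0 ac qp.
apply: (@le_trans _ _ (\sum_t (p t - q t))); first by rewrite sumrB subr_ge0.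
apply: ler_sum => t _; have := p0 t; rewrite le_eqVlt => /predU1P[<-|pt].
  by rewrite mul0r sub0r oppr_le0.
have qt : 0 < q t by rewrite lt_neqAle eq_sym ac // q0.
have h : ln (q t / p t) <= q t / p t - 1.
  have := @le_ln1Dx R (q t / p t - 1); rewrite [1 + _]addrC subrK; apply.
  by rewrite ltrBDl subrr divr_gt0.
rewrite -[p t / q t]invrK invf_div lnV ?posrE ?divr_gt0 //.
rewrite mulrN lerNr opprB; apply: le_trans (ler_wpM2l (p0 t) h) _.
by rewrite mulrBr mulrCA divff ?gt_eqF // mulr1 mulr1.
Qed.

(** Under [q], the likelihood of [z] is its maximal likelihood times the exponential of
    [- k * D(emp z || q)]. If [q] excludes a letter of [z], the left side is 0. *)
Lemma prod_le_of_divKL k T (z : {ffun 'I_k -> T}) (q : T -> R) (tau : R) :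
  (0 < k)%N -> (forall t, 0 <= q t) ->
  ((tau / k%:R)%:E <= divKL (emp z) q)%E ->
  \prod_i q (z i) <= expR (- tau) * \prod_i emp z (z i).
Proof.
move=> k0 q0 hd; have k0' : 0 < k%:R :> R by rewrite ltr0n.
have rhs0 : 0 <= expR (- tau) * \prod_i emp z (z i).
  by rewrite mulr_ge0 ?expR_ge0 // prodr_ge0 // => i _; exact: emp_ge0.
have [/existsP[i /eqP qi]|/existsPn qn0] := boolP [exists i, q (z i) == 0].
  by rewrite (bigD1 i) //= qi mul0r.
have ac t : 0 < emp z t -> q t != 0.
  rewrite /emp => h; have : (0 < cnt z t)%N.
    by rewrite lt0n; apply: contraTneq h => ->; rewrite mul0r ltxx.
  by move=> /cnt_gt0_ex[i <-].
move: hd; rewrite (divKL_klE (emp_ge0 z) ac) lee_fin => hd.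
apply: prod_le_exp_ln.
- by move=> i; rewrite lt_neqAle eq_sym qn0 q0.
- by move=> i; rewrite divr_gt0 // ltr0n cnt_gt0.
move: hd; rewrite ler_pdivrMr // => /le_trans; apply.
rewrite (sum_cntE z (fun t => ln (emp z t / q t))) /kl mulr_suml.
by apply: ler_sum => t _; rewrite mulrAC /emp divfK ?gt_eqF.
Qed.

End Types.
Arguments emp {R k T} z t.

(** * The two tests *)

Section Tests.
Variables (R : realType) (X Y : finType).
Implicit Types (P : X -> R) (Q V : X -> Y -> R) (Qs : Y -> R).

Lemma outm_ge0 P V b : is_dist P -> is_chan V -> 0 <= outm P V b.
Proof. by move=> [P0 _] hV; apply: sumr_ge0 => a _; rewrite mulr_ge0 // (hV a).1. Qed.

Lemma outm_dist P V : is_dist P -> is_chan V -> is_dist (outm P V).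
Proof.
move=> hP hV; split => [b|]; first exact: outm_ge0.
rewrite /outm exchange_big /= -hP.2; apply: eq_bigr => a _.
by rewrite -mulr_sumr (hV a).2 mulr1.
Qed.

Lemma joint_dist P V : is_dist P -> is_chan V -> is_dist (joint P V).
Proof.
move=> hP hV; split => [[a b]|]; first by rewrite mulr_ge0 ?hP.1 // (hV a).1.
rewrite -(pair_bigA _ (fun a b => P a * V a b)) /= -hP.2.
by apply: eq_bigr => a _; rewrite -mulr_sumr (hV a).2 mulr1.
Qed.

Lemma outm_gt0 P V a b : is_dist P -> is_chan V -> 0 < P a -> 0 < V a b ->
  0 < outm P V b.
Proof.
move=> hP hV Pa Vab; rewrite /outm (bigD1 a) //= ltr_pwDl ?mulr_gt0 //.
by apply: sumr_ge0 => a' _; rewrite mulr_ge0 ?hP.1 // (hV a').1.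
Qed.

Lemma mutinf_joint P V : is_dist P -> is_chan V ->
  mutinf (joint P V) = \sum_a P a * kl (V a) (outm P V).
Proof.
move=> hP hV; rewrite /mutinf big_mkcond /=.
under [RHS]eq_bigr do rewrite /kl mulr_sumr.
rewrite [RHS]pair_bigA /=; apply: eq_bigr => -[a b] _ /=.
have PV0 : 0 <= P a * V a b by rewrite mulr_ge0 ?hP.1 // (hV a).1.
rewrite {1 2}/joint /= mulrA; case: ifPn => [PV|]; last first.
  by rewrite lt_neqAle PV0 andbT negbK => /eqP <-; rewrite mul0r.
have Pa : 0 < P a.
  by rewrite lt_neqAle hP.1 andbT; apply: contraTneq PV => <-; rewrite mul0r ltxx.
congr (_ * ln _); rewrite /joint /= -mulr_sumr (hV a).2 mulr1 -/(outm P V b).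
by rewrite -mulf_div divff ?mul1r // gt_eqF.
Qed.

Lemma kl_joint P V Q : is_dist P -> is_chan V -> is_chan Q ->
  kl (joint P V) (joint P Q) = \sum_a P a * kl (V a) (Q a).
Proof.
move=> hP hV hQ; under [RHS]eq_bigr do rewrite /kl mulr_sumr.
rewrite [RHS]pair_bigA /=; apply: eq_bigr => -[a b] _ /=.
rewrite /joint /= mulrA; have := hP.1 a; rewrite le_eqVlt => /predU1P[<-|Pa].
  by rewrite !mul0r.
by rewrite -mulf_div divff ?mul1r // gt_eqF.
Qed.

(** Compensation identity: the average divergence to a common output law [r] exceeds the mutual
    information by the divergence of the output marginal from [r]. *)
Lemma sum_kl_outm P V (r : Y -> R) : is_dist P -> is_chan V ->
  (forall b, 0 <= r b) -> (forall b, 0 < outm P V b -> r b != 0) ->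
  \sum_b r b <= 1 ->
  mutinf (joint P V) <= \sum_a P a * kl (V a) r.
Proof.
move=> hP hV r0 ac r1.
suff -> : \sum_a P a * kl (V a) r = mutinf (joint P V) + kl (outm P V) r.
  by rewrite lerDl kl_ge0 // ?(outm_dist hP hV).2 // => b; exact: outm_ge0.
rewrite mutinf_joint // {2}/kl.
under [X in _ = _ + X]eq_bigr do rewrite {1}/outm mulr_suml.
rewrite [X in _ = _ + X]exchange_big /= -big_split; apply: eq_bigr => a _ /=.
rewrite /kl !mulr_sumr -big_split; apply: eq_bigr => b _ /=.
rewrite !mulrA -mulrDr.
have PV0 : 0 <= P a * V a b by rewrite mulr_ge0 ?hP.1 // (hV a).1.
move: (PV0); rewrite le_eqVlt => /predU1P[<-|PV]; first by rewrite !mul0r.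
have Pa : 0 < P a.
  by rewrite lt_neqAle hP.1 andbT; apply: contraTneq PV => <-; rewrite mul0r ltxx.
have Va : 0 < V a b by rewrite -(pmulr_rgt0 _ Pa).
have S0 := outm_gt0 hP hV Pa Va.
have rb : 0 < r b by rewrite lt_neqAle eq_sym ac // r0.
rewrite -lnM ?posrE ?divr_gt0 //; congr (_ * ln _).
by field; rewrite !gt_eqF.
Qed.

(* Likelihood ratio tests in which the unknown law of the outputs, resp. of the inputs given
   the outputs, is its maximum likelihood estimate: [testY] holds when
   [k * D(emp z || Qs) >= T1] and [testXY] when [k * D(J || P x J_Y) >= T2] for the joint
   type [J]. The latter divergence is at least the empirical mutual information. *)
Definition testY k Qs (T1 : R) (z : {ffun 'I_k -> Y}) : bool :=
  \prod_i Qs (z i) <= expR (- T1) * \prod_i emp z (z i).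

Definition testXY k P (T2 : R) (x : {ffun 'I_k -> X}) (z : {ffun 'I_k -> Y}) : bool :=
  \prod_i P (x i) <=
    expR (- T2) * \prod_i ((cnt (zipf x z) (x i, z i))%:R / (cnt z (z i))%:R).

Definition test k P Qs T1 T2 (x : {ffun 'I_k -> X}) (z : {ffun 'I_k -> Y}) : bool :=
  testY Qs T1 z && testXY P T2 x z.

(** When [testXY] holds, the weight of [x] is at most [expR (- T2)] times its conditional likelihood
    under the joint type, and these likelihoods have a polynomial sum. *)
Lemma test_false_alarm k P Qs T1 T2 (z : {ffun 'I_k -> Y}) :
  \sum_(x : {ffun 'I_k -> X}) (\prod_i P (x i)) * (test P Qs T1 T2 x z)%:R
  <= (testY Qs T1 z)%:R * (expR (- T2) * (k.+1 ^ (#|X| * #|Y|))%:R).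
Proof.
rewrite /test; case: (testY Qs T1 z) => /=; last by rewrite mul0r big1 // => x _; rewrite mulr0.
rewrite mul1r; apply: le_trans (ler_wpM2l (expR_ge0 _) (sum_prod_condl_le R X z)).
rewrite mulr_sumr; apply: ler_sum => x _.
case: (boolP (testXY P T2 x z)) => [|_]; first by rewrite mulr1.
by rewrite mulr0 mulr_ge0 ?expR_ge0 // prodr_ge0 // => i _; rewrite divr_ge0.
Qed.

(** As [testY] depends on the outputs alone, its factor [expR (- T1)] multiplies the factor
    [expR (- T2)] coming from the codeword. *)
Lemma test_false_alarm_noise k P Qs T1 T2 : (forall b, 0 <= Qs b) ->
  \sum_(z : {ffun 'I_k -> Y}) (\prod_i Qs (z i)) *
    \sum_(x : {ffun 'I_k -> X}) (\prod_i P (x i)) * (test P Qs T1 T2 x z)%:R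
  <= expR (- T1) * (k.+1 ^ #|Y|)%:R * (expR (- T2) * (k.+1 ^ (#|X| * #|Y|))%:R).
Proof.
move=> Qs0; set c := expR (- T2) * _.
have c0 : 0 <= c by rewrite mulr_ge0 ?expR_ge0.
apply: (@le_trans _ _ (\sum_z (expR (- T1) * \prod_i emp z (z i)) * c)); last first.
  rewrite -mulr_suml -mulr_sumr; apply: ler_wpM2r => //.
  by apply: ler_wpM2l; [exact: expR_ge0|exact: sum_prod_emp_le].
apply: ler_sum => z _.
apply: (@le_trans _ _ (\prod_i Qs (z i) * ((testY Qs T1 z)%:R * c))).
  by rewrite ler_wpM2l ?prodr_ge0 // test_false_alarm.
rewrite mulrA ler_wpM2r //; case: (boolP (testY Qs T1 z)) => [|_]; first by rewrite mulr1.
by rewrite mulr0 mulr_ge0 ?expR_ge0 // prodr_ge0 // => i _; exact: emp_ge0.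
Qed.

(** Failure of the noise test puts the type of [z] at divergence less than [thr] from the noise law,
    so the hypothesis on [W] applies to the type itself. *)
Lemma testY_miss k P Q Qs (gamma thr T1 : R) (z : {ffun 'I_k -> Y}) :
  is_dist P -> is_chan Q -> (forall b, 0 <= Qs b) -> (0 < k)%N ->
  T1 <= k%:R * thr ->
  (forall W, is_dist W -> (divKL W Qs < thr%:E)%E -> (gamma%:E <= divKL W (outm P Q))%E) ->
  ~~ testY Qs T1 z ->
  \prod_i outm P Q (z i) <= expR (- (k%:R * gamma)) * \prod_i emp z (z i).
Proof.
move=> hP hQ Qs0 k0 T1thr ha nt; have k0' : 0 < k%:R :> R by rewrite ltr0n.
apply: prod_le_of_divKL => // [b|]; first exact: outm_ge0.
rewrite mulrAC divff ?gt_eqF // mul1r; apply: ha; first exact: emp_dist.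
rewrite ltNge; apply: contraNN nt => h; apply: prod_le_of_divKL => //.
by apply: le_trans h; rewrite lee_fin ler_pdivrMr // mulrC.
Qed.

(** * Failure of the joint test for a codeword with nearly full letter counts *)

Section MissXY.
Variables (k : nat) (P : X -> R) (Q : X -> Y -> R) (w gamma thr T2 : R).
Variables (x : {ffun 'I_k -> X}) (z : {ffun 'I_k -> Y}).
Hypotheses (hP : is_dist P) (hQ : is_chan Q) (k0 : (0 < k)%N) (w0 : 0 < w).
Hypothesis x_typ : forall a, w * k%:R * P a <= (cnt x a)%:R.

Let n a b : R := (cnt (zipf x z) (a, b))%:R.
(** Conditional type of [z] given [x], completed by [Q] on the letters absent from [x]. By [x_typ]
    these have [P]-mass 0, so the completion does not affect [P]-averages. *)
Let V a b := if cnt x a == 0%N then Q a b else n a b / (cnt x a)%:R.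

Let n_eq0 a b : cnt x a = 0%N -> n a b = 0.
Proof.
move=> ca; have := cnt_zipl R x z a; rewrite ca => /eqP.
by rewrite psumr_eq0 // => /allP /(_ b (mem_index_enum _)) /eqP.
Qed.

Let nE a b : n a b = (cnt x a)%:R * V a b.
Proof.
rewrite /V; case: eqP => [ca|/eqP ca]; first by rewrite n_eq0 // ca mul0r.
by rewrite mulrCA divff ?mulr1 // pnatr_eq0.
Qed.

Let V_chan : is_chan V.
Proof.
move=> a; rewrite /V; case: eqP => [_|/eqP ca]; first exact: hQ.
split=> [b|]; first by rewrite divr_ge0.
by rewrite -mulr_suml cnt_zipl divff // pnatr_eq0.
Qed.

Let cnt_gt0P a : 0 < P a -> (0 < cnt x a)%N.
Proof.
move=> Pa; rewrite -(ltr0n R); apply: lt_le_trans (x_typ a).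
by rewrite !mulr_gt0 // ltr0n.
Qed.

Let V_gt0 a b : (0 < cnt x a)%N -> 0 < V a b -> exists i, x i = a /\ z i = b.
Proof.
move=> ca; rewrite /V gtn_eqF // => h.
have /cnt_gt0_ex[i] : (0 < cnt (zipf x z) (a, b))%N.
  by rewrite -(ltr0n R); move: h; rewrite pmulr_lgt0 // invr_gt0 ltr0n.
by rewrite ffunE => -[<- <-]; exists i.
Qed.

(** Each divergence [kl (V a) (q a)] with [a] occurring in [x] is nonnegative, so the counts may be
    replaced by their lower bounds [w * k * P a]. *)
Let sum_ln_ge q : (forall a b, 0 <= q a b) -> (forall a, \sum_b q a b <= 1) ->
  (forall a b, (0 < cnt x a)%N -> 0 < V a b -> q a b != 0) ->
  w * k%:R * \sum_a P a * kl (V a) (q a) <= \sum_i ln (V (x i) (z i) / q (x i) (z i)).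
Proof.
move=> q0 q1 ac.
have -> : \sum_i ln (V (x i) (z i) / q (x i) (z i)) =
    \sum_a (cnt x a)%:R * kl (V a) (q a).
  have := sum_cntE (zipf x z) (fun u => ln (V u.1 u.2 / q u.1 u.2)).
  under eq_bigr do rewrite ffunE /=.
  move=> ->; under [RHS]eq_bigr do rewrite /kl mulr_sumr.
  rewrite [RHS]pair_bigA; apply: eq_bigr => -[a b] _ /=.
  by rewrite mulrA -/(n a b) nE.
rewrite mulr_sumr; apply: ler_sum => a _; rewrite mulrA.
have [ca|ca] := posnP (cnt x a).
  suff -> : P a = 0 by rewrite ca mulr0 !mul0r.
  apply/eqP; rewrite eq_le hP.1 andbT leNgt; apply/negP => /cnt_gt0P.
  by rewrite ca.
rewrite ler_wpM2r // kl_ge0 //; first by move=> b; exact: (V_chan a).1.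
- by move=> b; exact: ac.
- by rewrite (V_chan a).2.
Qed.

Let V_xz i : V (x i) (z i) = n (x i) (z i) / (cnt x (x i))%:R.
Proof. by rewrite /V gtn_eqF // cnt_gt0. Qed.

Let n_xz i : 0 < n (x i) (z i).
Proof. by rewrite ltr0n; have := cnt_gt0 (zipf x z) i; rewrite ffunE. Qed.

(** A failed test bounds its log-likelihood ratio by [T2], hence the mutual information of
    [joint P V] by [thr]; the second hypothesis then bounds the divergence of [joint P V] from
    [joint P Q]. Passing from counts to [P] costs the factor [w] in both threshold and exponent. *)
Lemma testXY_miss :
  T2 <= w * k%:R * thr ->
  (forall V, is_chan V -> mutinf (joint P V) <= thr ->
     (gamma%:E <= divKL (joint P V) (joint P Q))%E) ->
  ~~ testXY P T2 x z ->
  \prod_i Q (x i) (z i) <= expR (- (w * k%:R * gamma)) *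
     \prod_i ((cnt (zipf x z) (x i, z i))%:R / (cnt x (x i))%:R).
Proof.
move=> hT2 hb nt.
have k0' : 0 < k%:R :> R by rewrite ltr0n.
have wk0 : 0 < w * k%:R by rewrite mulr_gt0.
have cx0 i : 0 < (cnt x (x i))%:R :> R by rewrite ltr0n cnt_gt0.
have cz0 i : 0 < (cnt z (z i))%:R :> R by rewrite ltr0n cnt_gt0.
have Px0 i : 0 < P (x i).
  rewrite lt_neqAle hP.1 andbT; apply: contraNneq nt => Pi.
  rewrite /testXY (bigD1 i) //= -Pi mul0r mulr_ge0 ?expR_ge0 //.
  by rewrite prodr_ge0 // => j _; rewrite divr_ge0.
have emp_ac b : (exists2 a, (0 < cnt x a)%N & 0 < V a b) -> emp z b != 0 :> R.
  move=> [a ca /(V_gt0 ca)[i [_ <-]]]; rewrite gt_eqF // divr_gt0 //.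
have emp1 := @emp_dist R _ _ z k0.
have mi_thr : mutinf (joint P V) <= thr.
  rewrite -(ler_pM2l wk0); apply: le_trans hT2.
  apply: (@le_trans _ _ (\sum_i ln (n (x i) (z i) / (cnt z (z i))%:R / P (x i)))); last first.
    rewrite leNgt; apply: contraNN nt => h; apply: prod_le_exp_ln.
    - exact: Px0.
    - by move=> i; apply: divr_gt0; [exact: n_xz|exact: cz0].
    - exact: ltW.
  apply: (@le_trans _ _ (\sum_i ln (V (x i) (z i) / emp z (z i)))).
    apply: le_trans (sum_ln_ge (q := fun=> emp z) _ _ _).
    - rewrite ler_wpM2l ?(ltW wk0) //; apply: sum_kl_outm => //.
      + exact: emp1.1.
      + move=> b Sb; apply: emp_ac; apply: contrapT => no.
        move: Sb; rewrite /outm big1 ?ltxx // => a _.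
        have := hP.1 a; rewrite le_eqVlt => /predU1P[<-|Pa]; first by rewrite mul0r.
        apply/eqP; rewrite mulf_eq0; apply/orP; right; rewrite eq_le (V_chan a).1 andbT.
        by rewrite leNgt; apply/negP => Vab; apply: no; exists a => //; exact: cnt_gt0P.
      + by rewrite emp1.2.
    - by move=> a b; exact: emp1.1.
    - by move=> a; rewrite emp1.2.
    - by move=> a b ca Vab; apply: emp_ac; exists a.
  (* The test statistic is taken relative to [P] instead of the type of [x]; this adds
     [k * D(emp x || P)], which is nonnegative. *)
  have -> : \sum_i ln (n (x i) (z i) / (cnt z (z i))%:R / P (x i)) =
      \sum_i ln (V (x i) (z i) / emp z (z i)) + \sum_i ln (emp x (x i) / P (x i)).
    rewrite -big_split; apply: eq_bigr => i _ /=.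
    have n0 := n_xz i; have p0 := Px0 i; have c0 := cx0 i; have c0' := cz0 i.
    rewrite -lnM ?posrE ?V_xz /emp ?divr_gt0 //; congr ln.
    by field; rewrite !gt_eqF.
  rewrite lerDl (sum_cntE x (fun a => ln (emp x a / P a))).
  have -> : \sum_a (cnt x a)%:R * ln (emp x a / P a) = k%:R * kl (emp x) P.
    rewrite /kl mulr_sumr; apply: eq_bigr => a _; rewrite mulrA; congr (_ * _).
    by rewrite mulrC /emp divfK // gt_eqF.
  rewrite mulr_ge0 // kl_ge0 //.
  - exact: emp_ge0.
  - exact: hP.1.
  - move=> a ea; have /cnt_gt0_ex[i <-] : (0 < cnt x a)%N.
      by rewrite -(ltr0n R); move: ea; rewrite /emp pmulr_lgt0 // invr_gt0.
    by rewrite gt_eqF.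
  - by rewrite hP.2 (emp_dist _ _ k0).2.
have {mi_thr}hd := hb V V_chan mi_thr.
have rhs0 : 0 <= expR (- (w * k%:R * gamma)) *
     \prod_i ((cnt (zipf x z) (x i, z i))%:R / (cnt x (x i))%:R).
  by rewrite mulr_ge0 ?expR_ge0 // prodr_ge0 // => i _; rewrite divr_ge0.
have [/existsP[i /eqP qi]|/existsPn qn0] := boolP [exists i, Q (x i) (z i) == 0].
  by rewrite (bigD1 i) //= qi mul0r.
have ac a b : 0 < V a b -> Q a b != 0.
  have [ca|ca /(V_gt0 ca)[i [<- <-]]] := posnP (cnt x a); last exact: qn0.
  by rewrite /V ca eqxx => h; rewrite gt_eqF.
move: hd; rewrite divKL_klE; last 2 first.
- exact: (joint_dist hP V_chan).1.
- move=> [a b]; rewrite /joint /= => h.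
  have Pa : P a != 0 by apply: contraTneq h => ->; rewrite mul0r ltxx.
  rewrite mulf_neq0 // ac //; have := (V_chan a).1 b; rewrite le_eqVlt => /predU1P[e|//].
  by move: h; rewrite -e mulr0 ltxx.
rewrite lee_fin kl_joint // => hd.
apply: prod_le_exp_ln.
- by move=> i; rewrite lt_neqAle eq_sym qn0 (hQ _).1.
- by move=> i; rewrite divr_gt0 //; exact: n_xz.
under eq_bigr do rewrite -V_xz.
apply: le_trans (sum_ln_ge (q := Q) _ _ _).
- by rewrite ler_wpM2l // ltW.
- by move=> a b; exact: (hQ a).1.
- by move=> a; rewrite (hQ a).2.
- by move=> a b _; exact: ac.
Qed.

End MissXY.

End Tests.

(** * Typical behaviour of the sent codeword: miss probability of order 1/k *)

Section TypicalMiss.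
Variables (R : realType) (X Y : finType) (P : X -> R) (Q : X -> Y -> R) (Qs : Y -> R).
Hypotheses (hP : is_dist P) (hQ : is_chan Q) (hQs : forall b, 0 <= Qs b).

Let S := outm P Q.

(** The type maximises the likelihood, so [S] may replace it. An output of noise probability 0 makes
    the test pass at once, which allows any finite [K] in place of the infinite log-likelihood
    ratio. *)
Lemma testY_llr k (K T1 : R) (z : {ffun 'I_k -> Y}) : (forall i, 0 < S (z i)) ->
  T1 <= \sum_i (if Qs (z i) == 0 then K else ln (S (z i) / Qs (z i))) ->
  testY Qs T1 z.
Proof.
move=> S0 h; rewrite /testY.
have [/existsP[i /eqP qi]|/existsPn qn0] := boolP [exists i, Qs (z i) == 0].
  rewrite (bigD1 i) //= qi mul0r mulr_ge0 ?expR_ge0 // prodr_ge0 // => j _.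
  exact: emp_ge0.
apply: (@le_trans _ _ (expR (- T1) * \prod_i S (z i))).
  apply: prod_le_exp_ln => // [i|]; first by rewrite lt_neqAle eq_sym qn0 hQs.
  by move: h; under eq_bigr do rewrite (negbTE (qn0 _)).
rewrite ler_wpM2l ?expR_ge0 // prod_le_emp //; first by move=> b; exact: outm_ge0.
by rewrite (outm_dist hP hQ).2.
Qed.

Lemma testXY_llr k (T2 : R) (x : {ffun 'I_k -> X}) (z : {ffun 'I_k -> Y}) :
  (0 < k)%N -> (forall i, 0 < P (x i)) -> (forall i, 0 < Q (x i) (z i)) ->
  T2 <= \sum_i ln (Q (x i) (z i) / S (z i)) -> testXY P T2 x z.
Proof.
move=> k0 P0 Q0 h; rewrite /testXY.
have k0' : 0 < k%:R :> R by rewrite ltr0n.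
have S0 i : 0 < S (z i) by apply: (outm_gt0 hP hQ (P0 i) (Q0 i)).
have c0 i : 0 < (cnt z (z i))%:R :> R by rewrite ltr0n cnt_gt0.
have e0 : 0 < \prod_i emp z (z i) :> R by apply: prodr_gt0 => i _; rewrite divr_gt0.
apply: (@le_trans _ _ (expR (- T2) * \prod_i (P (x i) * Q (x i) (z i) / S (z i)))).
  apply: prod_le_exp_ln => // [i|]; first by rewrite divr_gt0 ?mulr_gt0.
  apply: le_trans h _; apply/ler_sum => i _; rewrite le_eqVlt; apply/orP; left; apply/eqP.
  have p0 := P0 i; have s0 := S0 i; congr ln; by field; rewrite !gt_eqF.
(* Multiplying by the likelihood of [z] under its own type reduces the claim to maximum likelihood
   for pairs. The candidate [q] is the reverse channel [P Q / S] with output marginal [emp z]. *)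
rewrite ler_wpM2l ?expR_ge0 // -(ler_pM2r e0) -!big_split /=.
pose q (u : X * Y) := P u.1 * Q u.1 u.2 / S u.2 * emp z u.2.
have S_ge0 b : 0 <= S b by exact: outm_ge0.
have := @prod_le_emp R k _ (zipf x z) q.
under eq_bigr do rewrite ffunE /q /=; move=> hml.
apply: le_trans (hml _ _) _ => [[a b]||].
- by rewrite !mulr_ge0 ?invr_ge0 ?hP.1 ?(hQ _).1 ?emp_ge0.
- rewrite -(pair_bigA _ (fun a b => q (a, b))) exchange_big /=.
  rewrite -(emp_dist R z k0).2; apply: ler_sum => b _; rewrite /q /= -!mulr_suml -/(outm P Q b).
  have [->|Sb] := eqVneq (S b) 0; first by rewrite invr0 mulr0 mul0r emp_ge0.
  by rewrite -/S divff // mul1r.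
- rewrite le_eqVlt; apply/orP; left; apply/eqP; apply: eq_bigr => i _.
  have c1 := c0 i; rewrite /emp ffunE; by field; rewrite !gt_eqF.
Qed.

(** Chebyshev's inequality for the two log-likelihood ratio sums, whose means per symbol exceed [d1]
    and [d2]. The constant is uniform in [k] and in the thresholds. *)
Lemma test_miss_typical (K d1 : R) :
  d1 < \sum_b S b * (if Qs b == 0 then K else ln (S b / Qs b)) ->
  forall d2, d2 < mutinf (joint P Q) ->
  exists C : R, forall k T1 T2, (0 < k)%N -> T1 <= k%:R * d1 -> T2 <= k%:R * d2 ->
  \sum_(x : {ffun 'I_k -> X}) (\prod_i P (x i)) *
    \sum_(z : {ffun 'I_k -> Y}) (\prod_i Q (x i) (z i)) * (~~ test P Qs T1 T2 x z)%:R
  <= C / k%:R.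
Proof.
move=> hd1 d2 hd2.
pose f1 b := if Qs b == 0 then K else ln (S b / Qs b).
pose f2 (u : X * Y) := ln (Q u.1 u.2 / S u.2).
pose J := joint P Q; have hJ := joint_dist hP hQ.
pose m1 := \sum_u J u * f1 u.2; pose m2 := \sum_u J u * f2 u.
have m1E : m1 = \sum_b S b * f1 b.
  rewrite /m1 -(pair_bigA _ (fun a b => J (a, b) * f1 b)) exchange_big /=.
  by apply: eq_bigr => b _; rewrite -mulr_suml.
have m2E : m2 = mutinf (joint P Q).
  rewrite mutinf_joint // /m2 -(pair_bigA _ (fun a b => J (a, b) * f2 (a, b))) /=.
  apply: eq_bigr => a _; rewrite /kl mulr_sumr; apply: eq_bigr => b _.
  by rewrite /J /joint /f2 /= mulrA.
pose v1 := \sum_u J u * (f1 u.2 - m1) ^+ 2; pose v2 := \sum_u J u * (f2 u - m2) ^+ 2.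
have e1 : 0 < m1 - d1 by rewrite subr_gt0 m1E.
have e2 : 0 < m2 - d2 by rewrite subr_gt0 m2E.
exists (v1 / (m1 - d1) ^+ 2 + v2 / (m2 - d2) ^+ 2) => k T1 T2 k0 hT1 hT2.
have k0' : 0 < k%:R :> R by rewrite ltr0n.
rewrite mulrDl -!mulrA -!invfM.
under eq_bigr do rewrite mulr_sumr.
rewrite sum_pair_ffun.
apply: le_trans (lerD (chebyshev_prod hJ e1 k0 (f := fun u => f1 u.2) erefl)
                      (chebyshev_prod hJ e2 k0 (f := f2) erefl)).
rewrite [X in _ <= X + _]big_mkcond [X in _ <= _ + X]big_mkcond -big_split /=.
apply: ler_sum => u _.
set x := [ffun i => (u i).1]; set z := [ffun i => (u i).2].
have -> : \prod_i P (x i) * ((\prod_i Q (x i) (z i)) * (~~ test P Qs T1 T2 x z)%:R) =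
    \prod_i joint P Q (u i) * (~~ test P Qs T1 T2 x z)%:R.
  by rewrite mulrA -big_split /=; congr (_ * _); apply: eq_bigr => i _; rewrite !ffunE.
have Ju0 : 0 <= \prod_i joint P Q (u i) by apply: prodr_ge0 => i _; exact: hJ.1.
have if_ge0 (c : bool) : 0 <= (if c then \prod_i joint P Q (u i) else 0) by case: c.
case: (boolP (test _ _ _ _ _ _)) => [_|]; first by rewrite mulr0 addr_ge0.
rewrite mulr1 => nt.
(* Pairs of probability 0 contribute nothing; on the others every letter has positive probability,
   as the log-likelihood ratios require. *)
have [->|Jn0] := eqVneq (\prod_i joint P Q (u i)) 0; first by rewrite !if_same addr0.
have Jpos i : 0 < P (x i) /\ 0 < Q (x i) (z i).
  have : joint P Q (u i) != 0 by move/prodf_neq0: Jn0 => /(_ i isT).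
  rewrite /joint mulf_eq0 negb_or !ffunE => /andP[p q].
  by rewrite !lt_neqAle eq_sym p eq_sym q hP.1 (hQ _).1.
have Spos i : 0 < S (z i) by case: (Jpos i) => p q; exact: outm_gt0 p q.
have sum1E : \sum_i f1 (u i).2 = \sum_i f1 (z i).
  by apply: eq_bigr => i _; rewrite ffunE.
have sum2E : \sum_i f2 (u i) = \sum_i ln (Q (x i) (z i) / S (z i)).
  by apply: eq_bigr => i _; rewrite !ffunE.
move: nt; rewrite negb_and => /orP[nt|nt].
- have : \sum_i f1 (u i).2 < T1.
    by rewrite sum1E ltNge; apply: contraNN nt; exact: testY_llr.
  move=> lt1; rewrite ifT ?lerDl // -/m1.
  rewrite -normrN; apply: le_trans (ler_norm _).
  rewrite mulrBl [m1 * _]mulrC [d1 * _]mulrC; lra.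
- have : \sum_i f2 (u i) < T2.
    rewrite sum2E ltNge; apply: contraNN nt; apply: testXY_llr => // i; by case: (Jpos i).
  move=> lt2; rewrite [X in _ <= _ + X]ifT ?lerDr // -/m2.
  rewrite -normrN; apply: le_trans (ler_norm _).
  rewrite mulrBl [m2 * _]mulrC [d2 * _]mulrC; lra.
Qed.

End TypicalMiss.

(** * Exponentially small miss probability *)

Section ExponentialMiss.
Variables (R : realType) (X Y : finType) (P : X -> R) (Q : X -> Y -> R) (Qs : Y -> R).
Hypotheses (hP : is_dist P) (hQ : is_chan Q) (hQs : forall b, 0 <= Qs b).

Lemma sum_prod_outm k (F : {ffun 'I_k -> Y} -> R) :
  \sum_(x : {ffun 'I_k -> X}) (\prod_i P (x i)) *
    \sum_(z : {ffun 'I_k -> Y}) (\prod_i Q (x i) (z i)) * F z =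
  \sum_(z : {ffun 'I_k -> Y}) (\prod_i outm P Q (z i)) * F z.
Proof.
under eq_bigr do rewrite mulr_sumr.
rewrite exchange_big /=; apply: eq_bigr => z _.
rewrite /outm bigA_distr_bigA /= mulr_suml; apply: eq_bigr => x _.
by rewrite mulrA big_split.
Qed.

(** The output test is treated after averaging: domination by twice the i.i.d. law reduces it to
    i.i.d. outputs with law [outm P Q]. The joint test is treated codeword by codeword, where the
    bound on the letter counts applies. *)
Lemma test_miss_exponential k (pt : {ffun 'I_k -> X} -> R) (w g1 g2 thr1 thr2 T1 T2 : R) :
  (0 < k)%N -> 0 < w ->
  (forall x, 0 <= pt x <= 2 * \prod_i P (x i)) -> \sum_x pt x = 1 ->
  (forall x, pt x != 0 -> forall a, w * k%:R * P a <= (cnt x a)%:R) ->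
  T1 <= k%:R * thr1 -> T2 <= w * k%:R * thr2 ->
  (forall W, is_dist W -> (divKL W Qs < thr1%:E)%E -> (g1%:E <= divKL W (outm P Q))%E) ->
  (forall V, is_chan V -> mutinf (joint P V) <= thr2 ->
     (g2%:E <= divKL (joint P V) (joint P Q))%E) ->
  \sum_(x : {ffun 'I_k -> X}) pt x *
    \sum_(z : {ffun 'I_k -> Y}) (\prod_i Q (x i) (z i)) * (~~ test P Qs T1 T2 x z)%:R
  <= 2 * (expR (- (k%:R * g1)) * (k.+1 ^ #|Y|)%:R) +
     expR (- (w * k%:R * g2)) * (k.+1 ^ (#|X| * #|Y|))%:R.
Proof.
move=> k0 w0 hpt pt1 ptyp hT1 hT2 ha hb.
have Q0 (x : {ffun 'I_k -> X}) (z : {ffun 'I_k -> Y}) : 0 <= \prod_i Q (x i) (z i).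
  by apply: prodr_ge0 => i _; exact: (hQ _).1.
apply: (@le_trans _ _
  (\sum_(x : {ffun 'I_k -> X})
    (pt x * (\sum_(z : {ffun 'I_k -> Y}) (\prod_i Q (x i) (z i)) * (~~ testY Qs T1 z)%:R)
   + pt x * (\sum_(z : {ffun 'I_k -> Y}) (\prod_i Q (x i) (z i)) * (~~ testXY P T2 x z)%:R)))).
  apply: ler_sum => x _; rewrite -mulrDr ler_wpM2l ?(andP (hpt x)).1 //.
  rewrite -big_split; apply: ler_sum => z _ /=; rewrite -mulrDr ler_wpM2l //.
  by rewrite -natrD ler_nat negb_and; case: (~~ _) (~~ _) => [] [].
rewrite big_split; apply: lerD => /=.
  apply: (@le_trans _ _ (2 * \sum_(x : {ffun 'I_k -> X}) (\prod_i P (x i)) *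
      (\sum_(z : {ffun 'I_k -> Y}) (\prod_i Q (x i) (z i)) * (~~ testY Qs T1 z)%:R))).
    rewrite mulr_sumr; apply: ler_sum => x _; rewrite mulrA ler_wpM2r //.
      by apply: sumr_ge0 => z _; rewrite mulr_ge0.
    by case/andP: (hpt x).
  rewrite ler_pM2l // sum_prod_outm.
  apply: le_trans (ler_wpM2l (expR_ge0 _) (sum_prod_emp_le R k Y)).
  rewrite mulr_sumr; apply: ler_sum => z _.
  case: (boolP (testY Qs T1 z)) => [_|nt].
    by rewrite mulr0 mulr_ge0 ?expR_ge0 // prodr_ge0 // => i _; exact: emp_ge0.
  by rewrite mulr1; exact: testY_miss ha nt.
set rhs := expR _ * _.
rewrite -[leRHS]mul1r -[X in X * rhs]pt1 mulr_suml; apply: ler_sum => x _.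
have [->|ptx] := eqVneq (pt x) 0; first by rewrite !mul0r.
rewrite ler_wpM2l ?(andP (hpt x)).1 //.
apply: le_trans (ler_wpM2l (expR_ge0 _) (sum_prod_condr_le R Y x)).
rewrite mulr_sumr; apply: ler_sum => z _.
case: (boolP (testXY P T2 x z)) => [_|nt].
  by rewrite mulr0 mulr_ge0 ?expR_ge0 // prodr_ge0 // => i _; rewrite divr_ge0.
by rewrite mulr1; exact: testXY_miss (ptyp x ptx) hT2 hb nt.
Qed.

End ExponentialMiss.

(** * Random coding with a sequential decoder *)

Section Operational.
Variables (R : realType) (X Y : finType) (Q : X -> Y -> R) (star : X).
Hypothesis hQ : is_chan Q.
Variables (A M N : nat) (y0 : Y) (m0 : 'I_M).
Variable g : forall k, {ffun 'I_k -> X} -> {ffun 'I_k -> Y} -> bool.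

Let T := (A + N)%N.

Lemma nneseries_finite (f : nat -> \bar R) (n : nat) :
  (forall i, (n <= i)%N -> f i = 0%E) ->
  (\sum_(i <oo) f i = \sum_(0 <= i < n) f i)%E.
Proof.
move=> f0; apply: (@lim_near_cst (\bar R)) => //.
exists n => // m /= nm; rewrite (big_cat_nat (n := n)) //=.
rewrite [X in (_ + X)%E]big_nat_cond [X in (_ + X)%E]big1 ?adde0 //.
by move=> i /andP[/andP[ni _] _]; exact: f0.
Qed.

Definition codeprefix (k : 'I_N.+1) (a : {ffun 'I_N -> X}) : {ffun 'I_k -> X} :=
  [ffun j => a (widen_ord (ltn_ord k : (k <= N)%N) j)].

(** Outputs at times [s+1] to [s+k] in the 1-indexed time of [inp]. The default [y0] is never read
    when [s + k <= T]. *)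
Definition window (s k : nat) (y : {ffun 'I_T -> Y}) : {ffun 'I_k -> Y} :=
  [ffun j : 'I_k => nth y0 (codom y) (s + j)].

(* Convertible to [inp star c m l i] when [a] is the codeword [c m]; the outputs depend on
   the code only through it. *)
Definition inpw (a : {ffun 'I_N -> X}) (l i : nat) : X :=
  inp star (fun _ : 'I_1 => a) ord0 l i.

Definition Wout (a : {ffun 'I_N -> X}) (l : nat) (y : {ffun 'I_T -> Y}) : R :=
  \prod_(i < T) Q (inpw a l i.+1) (y i).

Lemma Wout_ge0 a l y : 0 <= Wout a l y.
Proof. by apply: prodr_ge0 => i _; exact: (hQ _).1. Qed.

Lemma sum_Wout a l : \sum_y Wout a l y = 1.
Proof.
rewrite (sum_prod_ffun (fun i : 'I_T => Q (inpw a l i.+1))).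
by apply: big1 => i _; exact: (hQ _).2.
Qed.

Lemma nth_codom (y : {ffun 'I_T -> Y}) i (iT : (i < T)%N) :
  nth y0 (codom y) i = y (Ordinal iT).
Proof.
rewrite codomE (nth_map (Ordinal iT)) ?size_enum_ord //; congr (y _).
by apply: val_inj => /=; rewrite nth_enum_ord.
Qed.

Lemma size_codom_T (y : {ffun 'I_T -> Y}) : size (codom y) = T.
Proof. by rewrite size_codom card_ord. Qed.

Lemma sum_window a l s k (G : {ffun 'I_k -> Y} -> R) : (s + k <= T)%N ->
  \sum_y Wout a l y * G (window s k y) =
  \sum_(z : {ffun 'I_k -> Y}) (\prod_(j < k) Q (inpw a l (s + j).+1) (z j)) * G z.
Proof.
move=> skT.
have eT (j : 'I_k) : (s + j < T)%N by apply: leq_trans skT; rewrite ltn_add2l.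
pose e j := Ordinal (eT j).
have einj : injective e by move=> i j [] /addnI /val_inj.
rewrite -(sum_prod_marg (f := fun i : 'I_T => Q (inpw a l i.+1)) (e := e)) //.
  apply: eq_bigr => y _; congr (_ * G _).
  by apply/ffunP => j; rewrite !ffunE nth_codom; congr (y _); exact: val_inj.
by move=> i; exact: (hQ _).2.
Qed.

(** Prefixes of all lengths are moved to one sample space of sequences of length [T], on which the
    stopping time becomes a random variable. *)
Lemma sum_pref_prob (c : 'I_M -> {ffun 'I_N -> X}) m l n (E : seq Y -> bool) :
  (n <= T)%N ->
  \sum_(t : n.-tuple Y | E t) pref_prob Q star (fun m i => c m i) m l t =
  \sum_y Wout (c m) l y * (E (take n (codom y)))%:R.
Proof.
move=> nT.
have -> : \sum_y Wout (c m) l y * (E (take n (codom y)))%:R =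
    \sum_y Wout (c m) l y * (E (codom (window 0 n y)))%:R.
  apply: eq_bigr => y _; congr (_ * (E _)%:R).
  apply: (@eq_from_nth _ y0).
    by rewrite size_takel ?size_codom_T // size_codom card_ord.
  move=> i; rewrite size_takel ?size_codom_T // => ni.
  rewrite nth_take // [in RHS]codomE (nth_map (Ordinal ni)) ?size_enum_ord //.
  by rewrite ffunE add0n nth_enum_ord.
rewrite (sum_window _ _ (fun z => (E (codom z))%:R)) ?add0n // big_mkcond /=.
rewrite [RHS](reindex (fun t : n.-tuple Y => [ffun i => tnth t i])) /=.
  apply: eq_bigr => t _.
  have -> : codom [ffun i => tnth t i] = t :> seq Y.
    rewrite -[in RHS](map_tnth_enum t) codomE; apply: eq_map => i; by rewrite ffunE.
  case: (E t); rewrite ?mulr0 // mulr1 /pref_prob; apply: eq_bigr => i _.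
  by rewrite ffunE add0n.
exists (fun z : {ffun 'I_n -> Y} => [tuple z i | i < n]) => [t _|z _].
  by apply: eq_from_tnth => i; rewrite tnth_mktuple ffunE.
by apply/ffunP => i; rewrite ffunE tnth_mktuple.
Qed.

(** * The sequential decoder for a fixed code *)

Section Decoder.
Variable c : {ffun 'I_M -> {ffun 'I_N -> X}}.
Implicit Types (y : {ffun 'I_T -> Y}).

Definition alarm (ys : seq Y) (m : 'I_M) (k : 'I_N.+1) : bool :=
  (k <= size ys)%N &&
  g (codeprefix k (c m)) [ffun j : 'I_k => nth y0 ys (size ys - k + j)].

Definition stop_rule (ys : seq Y) : bool :=
  (T <= size ys)%N || [exists m, exists k, alarm ys m k].

(** At the stopping time, the default [m0] can be returned without an alarm only when the horizon
    [T] forced the stop. *)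
Definition decode (ys : seq Y) : 'I_M :=
  odflt m0 [pick m | [exists k, alarm ys m k]].

Definition tau (y : {ffun 'I_T -> Y}) : nat :=
  find (fun n => stop_rule (take n (codom y))) (iota 0 T.+1).

Lemma has_stop y : has (fun n => stop_rule (take n (codom y))) (iota 0 T.+1).
Proof.
apply/hasP; exists T; first by rewrite mem_iota add0n ltnSn.
by rewrite /stop_rule size_takel ?size_codom_T // leqnn.
Qed.

Lemma tau_le y : (tau y <= T)%N.
Proof. by have := has_stop y; rewrite has_find size_iota ltnS. Qed.

Lemma stop_tau y : stop_rule (take (tau y) (codom y)).
Proof.
by have := nth_find 0%N (has_stop y); rewrite -/(tau y) nth_iota ?ltnS ?tau_le.
Qed.

Lemma tau_min y n : (n <= T)%N -> stop_rule (take n (codom y)) -> (tau y <= n)%N.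
Proof.
move=> nT sn; rewrite leqNgt; apply/negP => ntau.
by have := before_find 0%N ntau; rewrite nth_iota ?ltnS // add0n sn.
Qed.

Lemma first_stop_tau y n : (n <= T)%N ->
  first_stop stop_rule (take n (codom y)) = (tau y == n).
Proof.
move=> nT; have sz : size (take n (codom y)) = n by rewrite size_takel ?size_codom_T.
apply/idP/eqP => [/andP[sn /forallP h]|<-].
  apply/eqP; rewrite eqn_leq tau_min //= leqNgt; apply/negP => lt.
  rewrite -sz in lt; have := h (Ordinal lt) => /=.
  by rewrite take_takel ?stop_tau // -sz ltnW.
rewrite /first_stop stop_tau /=; apply/forallP => -[k /=].
rewrite size_takel ?size_codom_T ?tau_le // => kt.
rewrite take_takel ?(ltnW kt) //; apply/negP => /tau_min h.
by have := h (leq_trans (ltnW kt) (tau_le y)); rewrite leqNgt kt.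
Qed.

Lemma first_stop_long (n : nat) (t : n.-tuple Y) : (T < n)%N ->
  first_stop stop_rule t = false.
Proof.
move=> Tn; apply/negP => /andP[_ /forallP h].
have lt : (T < size t)%N by rewrite size_tuple.
have := h (Ordinal lt); rewrite /= /stop_rule size_takel ?leqnn //.
by rewrite size_tuple ltnW.
Qed.

Let cc (m : 'I_M) (i : 'I_N) := c m i.

Lemma p_tauE m l n : p_tau Q star cc stop_rule m l n =
  \sum_y Wout (c m) l y * (tau y == n)%:R.
Proof.
rewrite /p_tau; have [nT|Tn] := leqP n T.
  rewrite sum_pref_prob //; apply: eq_bigr => y _; by rewrite first_stop_tau.
rewrite big_pred0 ?[RHS]big1 // => [y _|t]; last exact: first_stop_long.
by rewrite ltn_eqF ?mulr0 // (leq_ltn_trans (tau_le y)).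
Qed.

Lemma p_tau_decE m l n m' : p_tau_dec Q star cc stop_rule decode m l n m' =
  \sum_y Wout (c m) l y * ((tau y == n) && (decode (take (tau y) (codom y)) == m'))%:R.
Proof.
rewrite /p_tau_dec; have [nT|Tn] := leqP n T.
  rewrite (sum_pref_prob _ _ _ (fun t => first_stop stop_rule t && (decode t == m'))) //.
  apply: eq_bigr => y _; rewrite first_stop_tau //.
  by case: eqP => [->|].
rewrite big_pred0 ?[RHS]big1 // => [y _|t]; last by rewrite first_stop_long.
by rewrite ltn_eqF ?mulr0 // (leq_ltn_trans (tau_le y)).
Qed.

Lemma sum_tau (F : nat -> R) y : \sum_(0 <= n < T.+1) F n * (tau y == n)%:R = F (tau y).
Proof.
rewrite big_mkord (bigD1 (inord (tau y))) //= inordK ?ltnS ?tau_le // eqxx mulr1.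
rewrite big1 ?addr0 // => i ne; case: eqP => [e|]; last by rewrite mulr0.
by move: ne; rewrite e inord_val eqxx.
Qed.

Lemma p_err_mlE m l : p_err_ml Q star cc stop_rule decode m l =
  (\sum_y Wout (c m) l y * (decode (take (tau y) (codom y)) != m)%:R)%:E.
Proof.
rewrite /p_err_ml (nneseries_finite (n := T.+1)); last first.
  move=> i Ti; rewrite p_tau_decE big1 // => y _.
  by rewrite ltn_eqF ?mulr0 // (leq_ltn_trans (tau_le y)).
rewrite sumEFin; under eq_bigr do rewrite p_tau_decE.
rewrite exchange_big -EFinB -[X in (X - _)%:E](sum_Wout (c m) l) -sumrB /=; congr (_%:E).
apply: eq_bigr => y _; set d := decode _ == m.
have -> : \sum_(0 <= n < T.+1) Wout (c m) l y * ((tau y == n) && d)%:R = Wout (c m) l y * d%:R.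
  rewrite -[RHS](sum_tau (fun=> Wout (c m) l y * d%:R) y).
  by apply: eq_bigr => n _; rewrite -mulnb natrM mulrA mulrAC.
by case: d; rewrite /= ?mulr1 ?mulr0 ?subrr ?subr0.
Qed.

Lemma delay_mlE m l : delay_ml Q star cc stop_rule m l =
  (\sum_y Wout (c m) l y * (tau y - l)%:R)%:E.
Proof.
have p0 i : (T.+1 <= i)%N -> p_tau Q star cc stop_rule m l i = 0.
  move=> Ti; rewrite p_tauE big1 // => y _.
  by rewrite ltn_eqF ?mulr0 // (leq_ltn_trans (tau_le y)).
rewrite /delay_ml !(nneseries_finite (n := T.+1)); last 2 first.
- by move=> i /p0 ->; rewrite ?mulr0.
- by move=> i /p0 ->; rewrite ?mulr0.
rewrite !sumEFin; under [X in (_ + (if (X%:E < _)%E then _ else _))%E]eq_bigr do rewrite p_tauE.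
rewrite exchange_big /= (eq_bigr (Wout (c m) l)); last first.
  by move=> y _; rewrite (sum_tau (fun=> Wout (c m) l y) y).
(* The stopping probabilities sum to 1, so the infinite-delay term vanishes. *)
rewrite sum_Wout ltxx adde0; congr (_%:E).
under eq_bigr do rewrite p_tauE mulr_sumr.
rewrite exchange_big /=; apply: eq_bigr => y _.
rewrite -(sum_tau (fun n => Wout (c m) l y * (n - l)%:R) y).
by apply: eq_bigr => n _; rewrite mulrA [_ * Wout _ _ _]mulrC.
Qed.

Lemma take_window k n y : (k <= n)%N -> (n <= T)%N ->
  [ffun j : 'I_k => nth y0 (take n (codom y)) (n - k + j)]
  = window (n - k) k y.
Proof.
move=> kn nT; apply/ffunP => j; rewrite !ffunE.
by rewrite nth_take // -[ltnRHS](subnK kn) ltn_add2l.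
Qed.

Lemma tau_le_window (k : 'I_N.+1) m s y : (s <= A)%N ->
  g (codeprefix k (c m)) (window s k y) -> (tau y <= s + k)%N.
Proof.
move=> sA pass; have skT : (s + k <= T)%N by rewrite leq_add // -ltnS.
apply: tau_min => //; apply/orP; right; apply/existsP; exists m; apply/existsP; exists k.
by rewrite /alarm size_takel ?size_codom_T // take_window ?leq_addl // addnK pass ?leq_addl.
Qed.

(** Since [s < A], the alarm of the sent codeword comes strictly before the horizon [T]; hence the
    stop is due to an alarm, and the decoded message is one that raised it. *)
Lemma decode_error (k : 'I_N.+1) m s y : (s < A)%N ->
  g (codeprefix k (c m)) (window s k y) -> decode (take (tau y) (codom y)) != m ->
  exists m' (k' : 'I_N.+1), [/\ m' != m, (k' <= tau y)%N, (tau y <= s + k)%N &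
    g (codeprefix k' (c m')) (window (tau y - k') k' y)].
Proof.
move=> sA pass; have taus := tau_le_window (ltnW sA) pass.
have tauT : (tau y < T)%N.
  by apply: leq_ltn_trans taus _; rewrite -addSn leq_add // -ltnS.
have := stop_tau y; rewrite /stop_rule size_takel ?size_codom_T ?tau_le // leqNgt tauT /=.
move=> ex; rewrite /decode; case: pickP => [m' /existsP[k' al] /= m'm|no]; last first.
  by case/existsP: ex => m'; rewrite no.
move: al; rewrite /alarm size_takel ?size_codom_T ?tau_le // => /andP[k'tau].
by rewrite take_window ?tau_le // => gg; exists m', k'.
Qed.

End Decoder.

(** * Averaging over random codebooks *)

Section RandomCoding.
Variables (P : X -> R) (pt : {ffun 'I_N -> X} -> R) (b1 b2 : R).
Hypotheses (pt_le : forall a, 0 <= pt a <= 2 * \prod_i P (a i)) (pt1 : \sum_a pt a = 1).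
Hypotheses (P1 : \sum_a P a = 1) (b1_ge0 : 0 <= b1) (b2_ge0 : 0 <= b2).
Hypothesis false_le : forall (k : 'I_N.+1) (z : {ffun 'I_k -> Y}),
  \sum_(x : {ffun 'I_k -> X}) (\prod_i P (x i)) * (g x z)%:R <= b2.
Hypothesis false_noise_le : forall k : 'I_N.+1,
  \sum_(z : {ffun 'I_k -> Y}) (\prod_i Q star (z i)) *
    \sum_(x : {ffun 'I_k -> X}) (\prod_i P (x i)) * (g x z)%:R <= b1.

Definition miss (k : 'I_N.+1) : R :=
  \sum_a pt a * \sum_(z : {ffun 'I_k -> Y})
    (\prod_j Q (codeprefix k a j) (z j)) * (~~ g (codeprefix k a) z)%:R.

Let omega (c : {ffun 'I_M -> {ffun 'I_N -> X}}) : R := \prod_m pt (c m).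

Let pt0 a : 0 <= pt a. Proof. by case/andP: (pt_le a). Qed.

Let omega0 c : 0 <= omega c. Proof. exact: prodr_ge0. Qed.

Let sum_omega : \sum_c omega c = 1.
Proof. by rewrite (sum_prod_ffun (fun=> pt)) big1. Qed.

Lemma inpw_codeword a s (k : 'I_N.+1) (j : 'I_k) :
  inpw a s.+1 (s + j).+1 = codeprefix k a j.
Proof.
have jN : (j < N)%N by apply: leq_trans (ltn_ord j) _; rewrite -ltnS.
rewrite /inpw /inp subSS addKn ifT; last by rewrite ltnS leq_addr -addSn ltn_add2l jN.
by rewrite insubT ffunE; congr (a _); exact: val_inj.
Qed.

Lemma inpw_noise a l i : (i < l)%N -> inpw a l i = star.
Proof. by move=> il; rewrite /inpw /inp leqNgt il. Qed.

Lemma avg_miss (k : 'I_N.+1) m s : (s < A)%N ->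
  \sum_c omega c * \sum_y Wout (c m) s.+1 y * (~~ g (codeprefix k (c m)) (window s k y))%:R
  = miss k.
Proof.
move=> sA; have skT : (s + k <= T)%N by apply: leq_add; [exact: ltnW|rewrite -ltnS].
pose H a := \sum_(z : {ffun 'I_k -> Y})
  (\prod_j Q (codeprefix k a j) (z j)) * (~~ g (codeprefix k a) z)%:R.
apply: (etrans _ (@sum_prod_marg1 _ _ _ (fun=> pt) m H (fun=> pt1))).
apply: eq_bigr => c _; congr (_ * _).
rewrite (sum_window _ _ (fun z => (~~ g (codeprefix k (c m)) z)%:R)) //.
apply: eq_bigr => z _; congr (_ * _); apply: eq_bigr => j _.
by rewrite inpw_codeword.
Qed.

Lemma sum_prefix_le (k : 'I_N.+1) (h : {ffun 'I_k -> X} -> R) :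
  (forall x, 0 <= h x) ->
  \sum_b pt b * h (codeprefix k b) <= 2 * \sum_(x : {ffun 'I_k -> X}) (\prod_i P (x i)) * h x.
Proof.
move=> h0; have winj : injective (widen_ord (ltn_ord k : (k <= N)%N)).
  by move=> i j /(congr1 (@nat_of_ord _)) /= /val_inj.
have /= <- := sum_prod_marg (f := fun=> P) h (fun=> P1) winj.
rewrite mulr_sumr; apply: ler_sum => b _; rewrite mulrA.
by rewrite ler_wpM2r //; case/andP: (pt_le b).
Qed.

(** The codeword of [m'] is independent of the outputs, which can be held fixed while averaging over
    it. A window ending before [l] contains only noise, and averaging over it gives [b1]. The factor
    2 comes from the domination of [pt]. *)
Lemma avg_false (k : 'I_N.+1) m m' n l : m' != m -> (k <= n <= T)%N ->
  \sum_c omega c *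
    \sum_y Wout (c m) l y * (g (codeprefix k (c m')) (window (n - k) k y))%:R
  <= 2 * (if (n < l)%N then b1 else b2).
Proof.
move=> m'm /andP[kn nT].
pose F (z : {ffun 'I_k -> Y}) :=
  \sum_(x : {ffun 'I_k -> X}) (\prod_i P (x i)) * (g x z)%:R.
rewrite (@sum_prod_marg2 _ _ _ (fun=> pt) m m' (fun a b =>
  \sum_y Wout a l y * (g (codeprefix k b) (window (n - k) k y))%:R)) //; last by rewrite eq_sym.
apply: (@le_trans _ _ (\sum_a pt a * \sum_y Wout a l y * (2 * F (window (n - k) k y)))).
  apply: ler_sum => a _; rewrite ler_wpM2l //.
  under eq_bigr do rewrite mulr_sumr.
  rewrite exchange_big /=; apply: ler_sum => y _.
  under eq_bigr do rewrite mulrCA.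
  by rewrite -mulr_sumr ler_wpM2l ?Wout_ge0 //;
    exact: (sum_prefix_le (fun x => ler0n _ (g x (window (n - k) k y)))).
rewrite -[leRHS]mul1r -[X in _ <= X * _]pt1 mulr_suml; apply: ler_sum => a _.
rewrite ler_wpM2l //; under eq_bigr do rewrite mulrCA.
rewrite -mulr_sumr ler_pM2l //; case: ifP => [nl|_].
  rewrite (sum_window _ _ F) ?subnK //; apply: le_trans (false_noise_le k).
  rewrite le_eqVlt; apply/orP; left; apply/eqP; apply: eq_bigr => z _.
  congr (_ * _); apply: eq_bigr => j _; rewrite inpw_noise //.
  by apply: leq_trans nl; rewrite ltnS -[leqRHS](subnK kn) -addnS leq_add2l.
rewrite -[leRHS]mul1r -[X in _ <= X * _](sum_Wout a l) mulr_suml.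
by apply: ler_sum => y _; rewrite ler_wpM2l ?Wout_ge0 //; exact: false_le.
Qed.

Variables (k1 k2 : 'I_N.+1).
Implicit Types (c : {ffun 'I_M -> {ffun 'I_N -> X}}).

(** Error bound: the sent codeword fails at length [k2], or a wrong one passes at some time
    [n < s + 1 + N]. Success at [k2] stops the receiver by time [s + N]. *)
Let u c m s : R := \sum_y Wout (c m) s.+1 y *
  ((~~ g (codeprefix k2 (c m)) (window s k2 y))%:R +
   \sum_(m' | m' != m) \sum_(k : 'I_N.+1) \sum_(n < s.+1 + N | (k <= n)%N)
      (g (codeprefix k (c m')) (window (n - k) k y))%:R).

(** Bound on the delay beyond [k1]: at most [N] if only the test at [k1] fails, because [k2 <= N],
    and at most [T] if both fail. *)
Let v c m s : R := \sum_y Wout (c m) s.+1 y *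
  (N%:R * (~~ g (codeprefix k1 (c m)) (window s k1 y))%:R +
   T%:R * (~~ g (codeprefix k2 (c m)) (window s k2 y))%:R).

(** Union bound over messages, window lengths and times: at most [A] times precede the codeword and
    cost [b1], the other [N] cost [b2]. *)
Let wrong : R := M%:R * (N.+1%:R * (2 * (A%:R * b1 + N%:R * b2))).

Let avg_u m s : (s < A)%N -> \sum_c omega c * u c m s <= miss k2 + wrong.
Proof.
move=> sA; rewrite /u.
under eq_bigr do (under eq_bigr do rewrite mulrDr; rewrite big_split mulrDr /=).
rewrite big_split /= avg_miss // lerD2l.
under eq_bigr do under eq_bigr do rewrite mulr_sumr.
under eq_bigr do rewrite exchange_big mulr_sumr /=.
rewrite exchange_big /=.
apply: (@le_trans _ _ (\sum_(m' < M) (N.+1%:R * (2 * (A%:R * b1 + N%:R * b2))))); last first.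
  by rewrite sumr_const card_ord -[leLHS]mulr_natl.
have tail0 : 0 <= 2 * (A%:R * b1 + N%:R * b2) by rewrite mulr_ge0 ?addr_ge0 ?mulr_ge0.
rewrite big_mkcond /=; apply: ler_sum => m' _; case: ifP => [m'm|_]; last by rewrite mulr_ge0.
under eq_bigr do under eq_bigr do rewrite mulr_sumr.
under eq_bigr do rewrite exchange_big mulr_sumr /=.
rewrite exchange_big /=.
apply: (@le_trans _ _ (\sum_(k : 'I_N.+1) (2 * (A%:R * b1 + N%:R * b2)))); last first.
  by rewrite sumr_const card_ord -[leLHS]mulr_natl.
apply: ler_sum => k _.
under eq_bigr do under eq_bigr do rewrite mulr_sumr.
under eq_bigr do rewrite exchange_big mulr_sumr /=.
rewrite exchange_big /=.
apply: (@le_trans _ _ (\sum_(n < s.+1 + N) (2 * (if (n < s.+1)%N then b1 else b2)))).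
  rewrite big_mkcond; apply: ler_sum => n _ /=; case: ifP => [kn|_]; last first.
    by rewrite mulr_ge0 //; case: ifP.
  apply: avg_false => //; rewrite kn /=; apply: leq_trans (ltnW (ltn_ord n)) _.
  by rewrite leq_add2r.
rewrite -mulr_sumr ler_pM2l // big_split_ord /= lerD //.
  rewrite (eq_bigr (fun=> b1)) => [|i _]; last by rewrite ltn_ord.
  by rewrite sumr_const card_ord -[b1 *+ _]mulr_natl ler_wpM2r // ler_nat.
rewrite (eq_bigr (fun=> b2)) => [|i _]; last by rewrite ltnNge leq_addr.
by rewrite sumr_const card_ord -[b2 *+ _]mulr_natl.
Qed.

Let avg_v m s : (s < A)%N -> \sum_c omega c * v c m s = N%:R * miss k1 + T%:R * miss k2.
Proof.
move=> sA; rewrite -(avg_miss k1 m sA) -(avg_miss k2 m sA) !mulr_sumr -big_split.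
apply: eq_bigr => c _ /=; rewrite ![_%:R * (omega c * _)]mulrCA -mulrDr; congr (_ * _).
rewrite !mulr_sumr -big_split; apply: eq_bigr => y _ /=.
by rewrite mulrDr; congr (_ + _); rewrite mulrCA.
Qed.

Let err_le c m s : (s < A)%N ->
  \sum_y Wout (c m) s.+1 y * (decode c (take (tau c y) (codom y)) != m)%:R <= u c m s.
Proof.
move=> sA; apply: ler_sum => y _; rewrite ler_wpM2l ?Wout_ge0 //.
have ge0 (m' : 'I_M) (k : 'I_N.+1) :
  0 <= \sum_(n < s.+1 + N | (k <= n)%N) (g (codeprefix k (c m')) (window (n - k) k y))%:R :> R.
  exact: sumr_ge0.
case: (boolP (g (codeprefix k2 (c m)) (window s k2 y))) => [pass|_] /=; last first.
  apply: (@le_trans _ _ 1); first by rewrite lern1 leq_b1.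
  by rewrite lerDl; apply: sumr_ge0 => m' _; exact: sumr_ge0.
rewrite add0r; case: eqP => [_|/eqP ne] /=.
  by apply: sumr_ge0 => m' _; exact: sumr_ge0.
have [m' [k [m'm ktau taus gg]]] := decode_error sA pass ne.
rewrite (bigD1 m') //= (bigD1 k) //=.
have tauN : (tau c y < s.+1 + N)%N.
  by apply: leq_ltn_trans taus _; rewrite addSn ltnS leq_add2l -ltnS.
rewrite (bigD1 (Ordinal tauN)) //= gg -!addrA lerDl.
by rewrite !addr_ge0 // sumr_ge0 // => m'' _; exact: sumr_ge0.
Qed.

Let del_le c m s : (s < A)%N ->
  \sum_y Wout (c m) s.+1 y * (tau c y - s.+1)%:R <= k1%:R + v c m s.
Proof.
move=> sA; have kE : k1%:R = \sum_y Wout (c m) s.+1 y * k1%:R.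
  by rewrite -mulr_suml sum_Wout mul1r.
rewrite [X in X + _]kE -big_split.
apply: ler_sum => y _ /=; rewrite -mulrDr ler_wpM2l ?Wout_ge0 //.
rewrite -!natrM -!natrD ler_nat.
case: (boolP (g (codeprefix k1 _) _)) => [/(tau_le_window (ltnW sA)) h|_] /=.
  by rewrite leq_subLR addSn; apply: leq_trans h _; lia.
case: (boolP (g (codeprefix k2 _) _)) => [/(tau_le_window (ltnW sA)) h|_] /=.
  by have := ltn_ord k2; lia.
by have := tau_le c y; lia.
Qed.

(** The error bound over [e] plus the excess delay bound over [B] has codebook average at most 1. A
    codebook not exceeding this average meets both bounds, as both terms are nonnegative. *)
Lemma random_coding (e B : R) : (0 < A)%N -> 0 < e -> 0 < B ->
  (miss k2 + wrong) / e + (N%:R * miss k1 + T%:R * miss k2) / B <= 1 ->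
  exists (c : 'I_M -> 'I_N -> X) (stop : seq Y -> bool) (dec : seq Y -> 'I_M),
    (p_err Q star A c stop dec <= e%:E)%E /\
    exists d : R, [/\ 0 <= d, d <= k1%:R + B & delay Q star A c stop = d%:E].
Proof.
move=> A0 e0 B0 h.
pose avg (F : 'I_M -> nat -> R) := (A * M)%:R^-1 * \sum_(m < M) \sum_(s < A) F m s.
have M0 : (0 < M)%N by apply: leq_ltn_trans (ltn_ord m0).
have AM0 : 0 < (A * M)%:R :> R by rewrite ltr0n muln_gt0 A0.
have avg_const x : avg (fun _ _ => x) = x.
  rewrite /avg !(sumr_const, card_ord) -mulrnA -[x *+ _]mulr_natl mulrA mulVf ?mul1r //.
  by rewrite gt_eqF.
have avg_le F G : (forall m s, (s < A)%N -> F m s <= G m s) -> avg F <= avg G.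
  move=> FG; apply: ler_wpM2l; first by rewrite invr_ge0 ltW.
  by apply: ler_sum => m _; apply: ler_sum => s _; exact: FG.
have avgD F G : avg (fun m s => F m s + G m s) = avg F + avg G.
  rewrite /avg -mulrDr -big_split; congr (_ * _); apply: eq_bigr => m _.
  by rewrite -big_split.
have avgM F x : avg (fun m s => F m s * x) = avg F * x.
  rewrite /avg -mulrA; congr (_ * _); rewrite mulr_suml; apply: eq_bigr => m _.
  by rewrite mulr_suml.
have avgE (F : 'I_M -> nat -> \bar R) (G : 'I_M -> nat -> R) :
    (forall m l, F m l = (G m l)%:E) ->
    (((A * M)%:R^-1)%:E * \sum_(m < M) \sum_(1 <= l < A.+1) F m l)%E =
    (avg (fun m s => G m s.+1))%:E.
  move=> FG; rewrite EFinM; congr (_ * _)%E; rewrite -sumEFin; apply: eq_bigr => m _.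
  rewrite -sumEFin big_add1 big_mkord; apply: eq_bigr => s _; exact: FG.
pose Phi c := avg (u c) / e + avg (v c) / B.
have [c Phi_le] : exists c, Phi c <= 1.
  apply: contrapT => no.
  have Phi_gt c : 1 < Phi c by rewrite ltNge; apply/negP => le; apply: no; exists c.
  have avg_exch F : \sum_c omega c * avg (F c) = avg (fun m s => \sum_c omega c * F c m s).
    rewrite /avg; under eq_bigr do rewrite mulrCA.
    rewrite -mulr_sumr; congr (_ * _).
    under eq_bigr do rewrite mulr_sumr.
    rewrite exchange_big; apply: eq_bigr => m _ /=.
    under eq_bigr do rewrite mulr_sumr.
    by rewrite exchange_big.
  have : \sum_c omega c * Phi c <= 1.
    apply: le_trans h; rewrite /Phi.
    under eq_bigr do rewrite mulrDr (mulrA _ (avg (u _))) (mulrA _ (avg (v _))).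
    rewrite big_split /= -!mulr_suml !avg_exch.
    apply: lerD; (apply: ler_wpM2r; first by rewrite invr_ge0 ltW).
      by rewrite -[leRHS]avg_const; apply: avg_le => m s; exact: avg_u.
    by rewrite -[leRHS]avg_const; apply: avg_le => m s sA; rewrite avg_v.
  (* If [Phi] exceeded 1 everywhere, these nonnegative terms would have sum at most 0, forcing all
     codebook probabilities to vanish. *)
  have ge0 c : 0 <= omega c * (Phi c - 1) by rewrite mulr_ge0 // subr_ge0 ltW.
  have sumE : \sum_c omega c * (Phi c - 1) = \sum_c omega c * Phi c - 1.
    by under eq_bigr do rewrite mulrBr mulr1; rewrite sumrB sum_omega.
  rewrite -subr_le0 -sumE => le0.
  have /eqP : \sum_c omega c * (Phi c - 1) = 0.
    by apply/eqP; rewrite eq_le le0 sumr_ge0.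
  rewrite psumr_eq0 // => /allP all0.
  have om0 c : omega c = 0.
    have := all0 c (mem_index_enum _); rewrite /= mulf_eq0 => /orP[/eqP //|].
    by rewrite subr_eq0 gt_eqF.
  have := sum_omega; rewrite big1 // => /eqP; by rewrite eq_sym oner_eq0.
have u0 m s : 0 <= u c m s.
  apply: sumr_ge0 => y _; rewrite mulr_ge0 ?Wout_ge0 // addr_ge0 //.
  by do 3 (apply: sumr_ge0 => ? _).
have v0 m s : 0 <= v c m s.
  by apply: sumr_ge0 => y _; rewrite mulr_ge0 ?Wout_ge0 // addr_ge0 // mulr_ge0.
have au0 : 0 <= avg (u c) by rewrite -[leLHS](avg_const 0); apply: avg_le => m s _.
have av0 : 0 <= avg (v c) by rewrite -[leLHS](avg_const 0); apply: avg_le => m s _.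
have au0' : 0 <= avg (u c) / e by rewrite divr_ge0 // ltW.
have av0' : 0 <= avg (v c) / B by rewrite divr_ge0 // ltW.
have au_le : avg (u c) <= e.
  by rewrite -[e]mul1r -ler_pdivrMr //; move: Phi_le; rewrite /Phi; lra.
have av_le : avg (v c) <= B.
  by rewrite -[B]mul1r -ler_pdivrMr //; move: Phi_le; rewrite /Phi; lra.
exists (fun m i => c m i), (stop_rule c), (decode c); split.
  rewrite /p_err (avgE _ _ (fun m l => p_err_mlE c m l)) lee_fin.
  by apply: le_trans au_le; apply: avg_le => m s sA; exact: err_le.
exists (avg (fun m s => \sum_y Wout (c m) s.+1 y * (tau c y - s.+1)%:R)); split.
- rewrite -[leLHS](avg_const 0); apply: avg_le => m s _.
  by apply: sumr_ge0 => y _; rewrite mulr_ge0 ?Wout_ge0.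
- apply: (@le_trans _ _ (k1%:R + avg (v c))); last by rewrite lerD2l.
  rewrite -[X in X + _]avg_const -avgD; apply: avg_le => m s sA; exact: del_le.
- by rewrite /delay (avgE _ _ (fun m l => delay_mlE c m l)).
Qed.

End RandomCoding.
End Operational.

(** * Asymptotics *)

Section Asymptotics.
Variable R : realType.

Lemma poly_exp_bound (d : nat) (r : R) : 0 < r ->
  exists2 C, 0 <= C & forall N : nat, N.+1%:R ^+ d * expR (- (r * N%:R)) <= C / N.+1%:R.
Proof.
(* The choice of [c] gives [N + 1 <= c * (1 + r N / (d + 1))]. Raising [1 + x <= expR x] to the
   power [d + 1] then leaves a spare factor [N + 1]. *)
move=> r0; pose c : R := d.+1%:R / r + 1.
have d0 : 0 < d.+1%:R :> R by rewrite ltr0n.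
have c0 : 0 <= c by rewrite addr_ge0 // divr_ge0 // ltW.
exists (c ^+ d.+1); first exact: exprn_ge0.
move=> N; rewrite ler_pdivlMr ?ltr0n // mulrAC -exprSr expRN.
rewrite ler_pdivrMr ?expR_gt0 //.
have -> : expR (r * N%:R) = expR (r * N%:R / d.+1%:R) ^+ d.+1.
  by rewrite -expRM_natr divfK // gt_eqF.
rewrite -exprMn lerXn2r ?nnegrE ?mulr_ge0 ?expR_ge0 //.
apply: (@le_trans _ _ (c * (1 + r * N%:R / d.+1%:R))); last first.
  by apply: ler_wpM2l => //; exact: expR_ge1Dx.
have -> : c * (1 + r * N%:R / d.+1%:R) =
    N.+1%:R + (d.+1%:R / r + r * N%:R / d.+1%:R).
  by rewrite /c -(natr1 N); field; rewrite !gt_eqF.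
rewrite lerDl addr_ge0 //; first by rewrite divr_ge0 // ltW.
by rewrite divr_ge0 // mulr_ge0 // ltW.
Qed.

Lemma nat_ge_real (x : R) : exists n : nat, x <= n%:R.
Proof. by exists (Num.truncn x).+1; rewrite ltW // truncnS_gt. Qed.

(** If [p] charges a letter that [q] excludes, a suitable [K] lifts the mean above [d]; otherwise
    [K] only multiplies zero masses. *)
Lemma ltedivKL_llr (Y : finType) (p q : Y -> R) (d : R) :
  is_dist p -> (d%:E < divKL p q)%E ->
  exists K, d < \sum_b p b * (if q b == 0 then K else ln (p b / q b)).
Proof.
move=> hp; rewrite /divKL; case: ifPn => [/existsP[b0 /andP[pb0 qb0]] _|/existsPn no].
  pose s : R := \sum_(b | q b != 0) p b * ln (p b / q b).
  pose p0 : R := \sum_(b | q b == 0) p b.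
  have p0_gt : 0 < p0.
    by rewrite /p0 (bigD1 b0) //= ltr_pwDl // sumr_ge0 // => b _; exact: hp.1.
  exists ((d - s + 1) / p0); rewrite (bigID (fun b => q b == 0)) /=.
  rewrite (eq_bigr (fun b => p b * ((d - s + 1) / p0))) => [|b ->] //.
  rewrite -mulr_suml -/p0 mulrCA divff ?gt_eqF // mulr1.
  rewrite (eq_bigr (fun b => p b * ln (p b / q b))) => [|b /negbTE ->] //.
  by rewrite -/s; lra.
rewrite lte_fin => h; exists 0; apply: lt_le_trans h _.
rewrite big_mkcond; apply: ler_sum => b _; have := no b; rewrite negb_and.
case: ifP => [pb|/negbT pb _] /=; first by move=> /negbTE ->.
suff -> : p b = 0 by rewrite mul0r.
by apply/eqP; rewrite eq_le hp.1 andbT leNgt.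
Qed.

Lemma lt_ereal_inf_gap (S : set (\bar R)) (a : R) : (a%:E < ereal_inf S)%E ->
  exists2 g, a < g & forall x, S x -> (g%:E <= x)%E.
Proof.
move=> h; have [g ag gS] : exists2 g, a < g & (g%:E <= ereal_inf S)%E.
  case: (ereal_inf S) h => [r| |//].
    by rewrite lte_fin => ar; exists r.
  (* The infimum is infinite, for instance over an empty set, and any gap works. *)
  by move=> _; exists (a + 1); rewrite ?ltrDl ?leey.
by exists g => // x Sx; apply: le_trans gS _; exact: ereal_inf_lbound.
Qed.

End Asymptotics.

(** * Codeword laws and choice of parameters *)

Section Achievability.
Variables (R : realType) (X Y : finType) (Q : X -> Y -> R) (star : X) (P : X -> R).
Hypotheses (hQ : is_chan Q) (hP : is_dist P).

Let Qs0 b : 0 <= Q star b. Proof. exact: (hQ star).1. Qed.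

Definition codeword_law N (pt : {ffun 'I_N -> X} -> R) : Prop :=
  (forall a, 0 <= pt a <= 2 * \prod_i P (a i)) /\ \sum_a pt a = 1.

Let tst T1 T2 k := @test R X Y k P (Q star) T1 T2.

Lemma iid_codeword_law N : codeword_law (fun a : {ffun 'I_N -> X} => \prod_i P (a i)).
Proof.
split=> [a|]; last by rewrite (sum_prod_ffun (fun=> P)) big1 // => i _; exact: hP.2.
have p0 : 0 <= \prod_i P (a i) by apply: prodr_ge0 => i _; exact: hP.1.
by rewrite p0 ler_peMl // ler1n.
Qed.

Lemma typical_codeword_law (w : R) : 0 < w < 1 -> exists N0, forall N, (N0 <= N)%N ->
  exists2 pt : {ffun 'I_N -> X} -> R, codeword_law pt &
    forall a, pt a != 0 -> forall x, w * N%:R * P x <= (cnt a x)%:R.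
Proof.
move=> /andP[w0 w1].
pose f (x b : X) : R := (b == x)%:R.
(* A letter with [P x = 0] contributes 0 through division by 0, in accordance with its empty
   constraint. *)
pose C : R := \sum_x (\sum_b P b * (f x b - P x) ^+ 2) / ((1 - w) * P x) ^+ 2.
have C0 : 0 <= C.
  apply: sumr_ge0 => x _; rewrite divr_ge0 ?sqr_ge0 // sumr_ge0 // => b _.
  by rewrite mulr_ge0 ?hP.1 ?sqr_ge0.
have [N0 hN0] := nat_ge_real (2 * C); exists N0.+1 => N N0N.
have N_gt0 : (0 < N)%N by apply: leq_trans N0N.
have N_gt0' : 0 < N%:R :> R by rewrite ltr0n.
pose pr (a : {ffun 'I_N -> X}) := \prod_i P (a i).
pose ty (a : {ffun 'I_N -> X}) := [forall x, w * N%:R * P x <= (cnt a x)%:R].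
have pr0 a : 0 <= pr a by apply: prodr_ge0 => i _; exact: hP.1.
have pr1 : \sum_a pr a = 1 by exact: (iid_codeword_law N).2.
have atyp : \sum_a pr a * (~~ ty a)%:R <= C / N%:R.
  rewrite /C mulr_suml.
  apply: (@le_trans _ _ (\sum_x \sum_(a : {ffun 'I_N -> X}) pr a *
      ((0 < P x) && ((cnt a x)%:R < w * N%:R * P x))%:R)).
    rewrite exchange_big /=; apply: ler_sum => a _.
    have ge0 x : 0 <= pr a * ((0 < P x) && ((cnt a x)%:R < w * N%:R * P x))%:R.
      by rewrite mulr_ge0.
    case: (boolP (ty a)) => [_|/forallPn[x]]; first by rewrite mulr0 sumr_ge0.
    rewrite -ltNge => lt; rewrite (bigD1 x) //= lt andbT.
    have Px : 0 < P x.
      rewrite lt_neqAle hP.1 andbT; apply: contraTneq lt => <-.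
      by rewrite mulr0 -leNgt.
    by rewrite Px lerDl sumr_ge0.
  apply: ler_sum => x _; have := hP.1 x; rewrite le_eqVlt => /predU1P[Px|Px].
    rewrite -Px ltxx /= mulr0 expr0n invr0 mulr0 mul0r.
    by rewrite big1 // => a _; rewrite mulr0.
  have mu : P x = \sum_b P b * f x b.
    rewrite (bigD1 x) //= /f eqxx mulr1 big1 ?addr0 // => b /negbTE ->.
    by rewrite mulr0.
  have e0 : 0 < (1 - w) * P x by rewrite mulr_gt0 // subr_gt0.
  rewrite -[leRHS]mulrA -invfM; apply: le_trans (chebyshev_prod hP e0 N_gt0 mu).
  rewrite [leRHS]big_mkcond; apply: ler_sum => a _ /=.
  case: ifP => [_|/negP dev]; first by rewrite ler_piMr // lern1 leq_b1.
  rewrite Px; case: ltP => [lt|_]; last by rewrite mulr0.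
  case: dev; have -> : \sum_i f x (a i) = (cnt a x)%:R by rewrite natr_sum.
  rewrite -normrN; apply: le_trans (ler_norm _).
  rewrite opprB lerBrDr -lerBrDl; apply: le_trans (ltW lt) _.
  by rewrite le_eqVlt; apply/orP; left; apply/eqP; ring.
pose Z := \sum_a pr a * (ty a)%:R.
have Z_ge : 1 / 2 <= Z.
  have : Z + \sum_a pr a * (~~ ty a)%:R = 1.
    rewrite -big_split -[RHS]pr1; apply: eq_bigr => a _ /=.
    by case: (ty a); rewrite mulr0 mulr1 ?addr0 ?add0r.
  have : C / N%:R <= 1 / 2.
    rewrite ler_pdivrMr //; have : N0%:R <= N%:R :> R by rewrite ler_nat ltnW.
    lra.
  lra.
have Z0 : 0 < Z by lra.
exists (fun a => pr a * (ty a)%:R / Z).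
  split=> [a|]; last by rewrite -mulr_suml divff // gt_eqF.
  rewrite divr_ge0 ?mulr_ge0 ?(ltW Z0) //= ler_pdivrMr //.
  apply: (@le_trans _ _ (pr a)); first by rewrite ler_piMr // lern1 leq_b1.
  rewrite mulrAC ler_peMl // ; lra.
move=> a; rewrite !mulf_eq0 !negb_or => /andP[/andP[_ ta] _] x.
by move: ta; case: (boolP (ty a)) => [/forallP /(_ x)|]; rewrite ?eqxx.
Qed.

Lemma miss_ord_max N (g : forall k, {ffun 'I_k -> X} -> {ffun 'I_k -> Y} -> bool)
    (pt : {ffun 'I_N -> X} -> R) :
  miss Q g pt ord_max = \sum_a pt a * \sum_(z : {ffun 'I_N -> Y})
    (\prod_j Q (a j) (z j)) * (~~ g N a z)%:R.
Proof.
have pE (a : {ffun 'I_N -> X}) : codeprefix ord_max a = a.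
  by apply/ffunP => j; rewrite ffunE; congr (a _); exact: val_inj.
by apply: eq_bigr => a _; rewrite pE.
Qed.

Lemma miss_le N (g : forall k, {ffun 'I_k -> X} -> {ffun 'I_k -> Y} -> bool)
    (pt : {ffun 'I_N -> X} -> R) (k : 'I_N.+1) : codeword_law pt ->
  miss Q g pt k <= 2 * \sum_(x : {ffun 'I_k -> X}) (\prod_i P (x i)) *
    \sum_(z : {ffun 'I_k -> Y}) (\prod_i Q (x i) (z i)) * (~~ g k x z)%:R.
Proof.
move=> [pt_le _]; apply: (sum_prefix_le pt_le hP.2 (h := fun x =>
  \sum_(z : {ffun 'I_k -> Y}) (\prod_i Q (x i) (z i)) * (~~ g k x z)%:R)).
move=> x; apply: sumr_ge0 => z _; rewrite mulr_ge0 // prodr_ge0 // => i _.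
exact: (hQ _).1.
Qed.

Lemma random_coding_test A M N T1 T2 (pt : {ffun 'I_N -> X} -> R) (k1 k2 : 'I_N.+1)
    (e B : R) :
  codeword_law pt -> (0 < A)%N -> (0 < M)%N -> 0 < e -> 0 < B ->
  (miss Q (tst T1 T2) pt k2 + M%:R * (N.+1%:R * (2 *
      (A%:R * (expR (- T1) * N.+1%:R ^+ #|Y| * (expR (- T2) * N.+1%:R ^+ (#|X| * #|Y|)))
       + N%:R * (expR (- T2) * N.+1%:R ^+ (#|X| * #|Y|)))))) / e
  + (N%:R * miss Q (tst T1 T2) pt k1 + (A + N)%:R * miss Q (tst T1 T2) pt k2) / B <= 1 ->
  exists (c : 'I_M -> 'I_N -> X) (stop : seq Y -> bool) (dec : seq Y -> 'I_M),
    (p_err Q star A c stop dec <= e%:E)%E /\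
    exists d : R, [/\ 0 <= d, d <= k1%:R + B & delay Q star A c stop = d%:E].
Proof.
move=> [pt_le pt1] A0 M0 e0 B0.
have [y0 _] : exists y0 : Y, true.
  apply: contrapT => no; have := (hQ star).2; rewrite big1.
    by move/eqP; rewrite eq_sym oner_eq0.
  by move=> y _; case: no; exists y.
have pow_le (k : 'I_N.+1) d : (k.+1 ^ d)%:R <= N.+1%:R ^+ d :> R.
  by rewrite natrX lerXn2r ?nnegrE // ler_nat.
apply: (@random_coding _ _ _ _ _ hQ A M N y0 (Ordinal M0) (tst T1 T2) P pt) => //.
- exact: hP.2.
- move=> k z; apply: le_trans (test_false_alarm P (Q star) T1 T2 z) _.
  apply: (@le_trans _ _ (expR (- T2) * (k.+1 ^ (#|X| * #|Y|))%:R)).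
    by rewrite ler_piMl ?mulr_ge0 ?expR_ge0 // lern1 leq_b1.
  by rewrite ler_wpM2l ?expR_ge0.
- move=> k; apply: le_trans (test_false_alarm_noise k P T1 T2 Qs0) _.
  by rewrite ler_pM ?mulr_ge0 ?expR_ge0 // ler_wpM2l ?expR_ge0.
Qed.

Lemma miss_ge0 N (g : forall k, {ffun 'I_k -> X} -> {ffun 'I_k -> Y} -> bool)
    (pt : {ffun 'I_N -> X} -> R) (k : 'I_N.+1) : codeword_law pt -> 0 <= miss Q g pt k.
Proof.
move=> [pt_le _]; apply: sumr_ge0 => a _; case/andP: (pt_le a) => pt0 _.
rewrite mulr_ge0 // sumr_ge0 // => z _; rewrite mulr_ge0 // prodr_ge0 // => i _.
exact: (hQ _).1.
Qed.

(** * Codes with about [expR (lam * N)] messages and target rate [rho] *)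

Section Rates.
Variables (lam t1 t2 rho K : R).
Hypotheses (lam0 : 0 < lam) (t1_ge0 : 0 <= t1) (t2_gt1 : 1 < t2).
Hypothesis lam_lt : lam * t2 < mutinf (joint P Q).
Hypothesis llr_gt : t1 / t2 * mutinf (joint P Q) <
  \sum_b outm P Q b * (if Q star b == 0 then K else ln (outm P Q b / Q star b)).
Hypothesis rho_lt : rho * t2 < mutinf (joint P Q).

Let tstN N := tst (t1 * lam * N%:R) (t2 * lam * N%:R).

Lemma typical_window : exists beta C : R, [/\ 0 < beta, 0 <= C &
  exists N0, forall N, (N0 <= N)%N -> exists k : 'I_N.+1,
    rho * (k%:R + beta * N%:R) <= lam * N%:R /\
    forall pt : {ffun 'I_N -> X} -> R, codeword_law pt -> N%:R * miss Q (tstN N) pt k <= C].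
Proof.
have t2_gt0 : 0 < t2 := lt_trans ltr01 t2_gt1.
pose I := mutinf (joint P Q).
pose m := Num.max (rho * t2) (lam * t2); pose d2 := (m + I) / 2.
have mI : m < I by rewrite /I gt_max rho_lt lam_lt.
have m1 : rho * t2 <= m by rewrite le_max lexx.
have m2 : lam * t2 <= m by rewrite le_max lexx orbT.
have d2I : d2 < I := (midf_lt mI).2.
have md2 : m < d2 := (midf_lt mI).1.
have d2r : rho * t2 < d2 := le_lt_trans m1 md2.
have d2l : lam * t2 < d2 := le_lt_trans m2 md2.
have d2_gt0 : 0 < d2 by apply: le_lt_trans d2l; rewrite mulr_ge0 // ltW.
(* The two thresholds are in the ratio [t1 / t2], so this is the drift that lets the noise test pass
   at the same window length. *)
have d1_lt : t1 / t2 * d2 < \sum_b outm P Q b *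
    (if Q star b == 0 then K else ln (outm P Q b / Q star b)).
  apply: le_lt_trans llr_gt; apply: ler_wpM2l; last exact: ltW.
  by apply: divr_ge0 => //; exact: ltW.
have [C1 hC1] := test_miss_typical hP hQ Qs0 d1_lt d2I.
pose x := rho * t2 / d2; pose y := lam * t2 / d2.
have x1 : x < 1 by rewrite /x ltr_pdivrMr // mul1r.
have y1 : y < 1 by rewrite /y ltr_pdivrMr // mul1r.
have y0 : 0 < y by rewrite /y divr_gt0 // mulr_gt0.
(* One [beta * N] is the allowed excess delay, a second absorbs the rounding of [k]; hence the 2.
   The target [rho] may be zero or negative, hence the absolute value and the added 1. *)
pose beta := lam * (1 - x) / (2 * (`|rho| + 1)).
have rho1 : 0 < `|rho| + 1 by rewrite ltr_pwDr.
have beta0 : 0 < beta.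
  by rewrite /beta divr_gt0 // mulr_gt0 // subr_gt0.
have betaE : beta * (2 * (`|rho| + 1)) = lam * (1 - x).
  by rewrite /beta divfK // mulf_neq0 // gt_eqF.
exists beta, (2 * `|C1| / y); split => //.
  by rewrite divr_ge0 ?(ltW y0) // mulr_ge0.
have [Na hNa] := nat_ge_real (1 - y)^-1.
have [Nb hNb] := nat_ge_real beta^-1.
exists (maxn 1 (maxn Na Nb)) => N; rewrite !geq_max => /and3P[N_gt0 NaN NbN].
have N0 : 0 < N%:R :> R by rewrite ltr0n.
have yN : 1 <= (1 - y) * N%:R.
  rewrite -ler_pdivrMl ?subr_gt0 // mulr1; apply: le_trans hNa _; by rewrite ler_nat.
have bN : 1 <= beta * N%:R.
  rewrite -ler_pdivrMl // mulr1; apply: le_trans hNb _; by rewrite ler_nat.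
pose k := (Num.truncn (y * N%:R)).+1.
have yN_ge0 : 0 <= y * N%:R by rewrite mulr_ge0 // ltW.
have k_gt : y * N%:R < k%:R by rewrite truncnS_gt.
have k_le : k%:R <= y * N%:R + 1.
  by rewrite /k -natr1 lerD2r truncn_le.
have kN : (k < N.+1)%N.
  rewrite ltnS -(ler_nat R); apply: le_trans k_le _.
  by move: yN; rewrite mulrBl mul1r lerBrDl.
have k_gt0 : 0 < k%:R :> R by rewrite ltr0n.
exists (Ordinal kN); split => [|pt hpt] /=.
  have sum_ge0 : 0 <= k%:R + beta * N%:R by rewrite addr_ge0 // mulr_ge0 // ltW.
  have [rho_neg|rho_pos] := leP rho 0.
    by apply: (@le_trans _ _ 0); [rewrite mulr_le0_ge0|rewrite mulr_ge0 // ltW].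
  have k_le2 : k%:R + beta * N%:R <= y * N%:R + 2 * (beta * N%:R).
    by rewrite mulr_natl mulr2n addrA lerD2r; apply: le_trans k_le _; rewrite lerD2l.
  apply: le_trans (ler_wpM2l (ltW rho_pos) k_le2) _.
  have -> : rho * (y * N%:R + 2 * (beta * N%:R)) =
      (x * lam + beta * (2 * `|rho|)) * N%:R.
    by rewrite gtr0_norm // /x /y; field; rewrite gt_eqF.
  rewrite ler_wpM2r //; apply: (@le_trans _ _ (x * lam + beta * (2 * (`|rho| + 1)))).
    by rewrite lerD2l ler_pM2l // ler_pM2l // lerDl.
  by rewrite betaE mulrBr mulr1 [lam * x]mulrC addrC subrK.
have hT1 : t1 * lam * N%:R <= k%:R * (t1 / t2 * d2).
  have -> : t1 * lam * N%:R = (y * N%:R) * (t1 / t2 * d2).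
    by rewrite /y; field; rewrite !gt_eqF.
  apply: ler_wpM2r; last exact: ltW.
  apply: mulr_ge0; last exact: ltW.
  by apply: divr_ge0 => //; exact: ltW.
have hT2 : t2 * lam * N%:R <= k%:R * d2.
  have -> : t2 * lam * N%:R = (y * N%:R) * d2 by rewrite /y; field; rewrite !gt_eqF.
  by apply: ler_wpM2r; exact: ltW.
have miss_k : miss Q (tstN N) pt (Ordinal kN) <= 2 * (C1 / k%:R).
  apply: le_trans (miss_le _ _ hpt) _; rewrite ler_pM2l //.
  exact: (hC1 k _ _ _ hT1 hT2).
apply: (@le_trans _ _ (N%:R * (2 * (`|C1| / (y * N%:R))))).
  apply: ler_wpM2l => //; apply: le_trans miss_k _; rewrite ler_pM2l //.
  apply: (@le_trans _ _ (`|C1| / k%:R)).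
    by rewrite ler_pM2r ?invr_gt0 // ler_norm.
  apply: ler_wpM2l => //; apply: ltW.
  by rewrite ltf_pV2 ?posrE //; exact: mulr_gt0.
by rewrite le_eqVlt; apply/orP; left; apply/eqP; field; rewrite !gt_eqF.
Qed.

(** The union over messages costs [expR (lam * N)], leaving exponent [(t2 - 1) * lam] during the
    codeword and, with the factor [A], at least [r] in pure noise. Type counts, window lengths and
    times contribute only a polynomial. *)
Lemma wrong_codeword_bound (r : R) : 0 < r -> r <= (t2 - 1) * lam ->
  exists2 C, 0 <= C & forall N A M : nat, (0 < N)%N ->
    M%:R <= 2 * expR (lam * N%:R) ->
    A%:R * expR (- ((t1 + t2 - 1) * lam * N%:R)) <= 2 * expR (- (r * N%:R)) ->
    forall e1 e2, e1 = expR (- (t1 * lam * N%:R)) -> e2 = expR (- (t2 * lam * N%:R)) ->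
    M%:R * (N.+1%:R * (2 * (A%:R * (e1 * N.+1%:R ^+ #|Y| * (e2 * N.+1%:R ^+ (#|X| * #|Y|)))
       + N%:R * (e2 * N.+1%:R ^+ (#|X| * #|Y|))))) <= C / N%:R.
Proof.
move=> r0 rle; have [C0 C0_ge0 hC0] := poly_exp_bound (#|Y| + #|X| * #|Y| + 2) r0.
exists (12 * C0) => [|N A M N0 hM hA e1 e2 e1E e2E]; first by rewrite mulr_ge0.
pose p : R := N.+1%:R; pose a := p ^+ #|Y|; pose b := p ^+ (#|X| * #|Y|).
pose u := expR (- (r * N%:R)); pose E := expR (lam * N%:R).
have p1 : 1 <= p by rewrite ler1n.
have p_ge0 : 0 <= p by rewrite ler0n.
have a1 : 1 <= a by rewrite exprn_ege1.
have b1 : 1 <= b by rewrite exprn_ege1.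
have a0 : 0 <= a by apply: le_trans a1.
have b0 : 0 <= b by apply: le_trans b1.
have E0 : 0 <= E by exact: expR_ge0.
have u0 : 0 <= u by exact: expR_ge0.
have Ee : A%:R * (E * e1 * e2) <= 2 * u.
  apply: le_trans hA; rewrite /E e1E e2E -!expRD le_eqVlt; apply/orP; left; apply/eqP.
  by congr (_ * expR _); ring.
have Ee2 : E * e2 <= u.
  rewrite /E e2E /u -expRD ler_expR.
  have -> : lam * N%:R + - (t2 * lam * N%:R) = - ((t2 - 1) * lam * N%:R) by ring.
  by rewrite lerN2 ler_wpM2r.
have e1_ge0 : 0 <= e1 by rewrite e1E expR_ge0.
have e2_ge0 : 0 <= e2 by rewrite e2E expR_ge0.
rewrite -/p -/a -/b.
apply: (@le_trans _ _ ((2 * E) * (p * (2 * (A%:R * (e1 * a * (e2 * b)) + p * a * (e2 * b)))))).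
  have NpE : N%:R * (e2 * b) <= p * a * (e2 * b).
    rewrite ler_wpM2r ?mulr_ge0 //; apply: (@le_trans _ _ p); first by rewrite ler_nat.
    by rewrite ler_peMr.
  have Ab : 0 <= A%:R * (e1 * a * (e2 * b)) by rewrite !mulr_ge0.
  have Nb : 0 <= N%:R * (e2 * b) by rewrite !mulr_ge0.
  apply: ler_pM => //; first by rewrite !mulr_ge0 ?addr_ge0.
  by apply: ler_wpM2l => //; rewrite ler_pM2l // lerD2l.
have -> : (2 * E) * (p * (2 * (A%:R * (e1 * a * (e2 * b)) + p * a * (e2 * b)))) =
    4 * (a * b * p) * (A%:R * (E * e1 * e2) + p * (E * e2)) by ring.
apply: (@le_trans _ _ (4 * (a * b * p) * (p * (3 * u)))).
  apply: ler_wpM2l; first by rewrite !mulr_ge0.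
  have h1 : A%:R * (E * e1 * e2) <= p * (2 * u).
    by apply: le_trans Ee _; rewrite ler_peMl // mulr_ge0.
  have h2 : p * (E * e2) <= p * u by rewrite ler_wpM2l.
  have -> : p * (3 * u) = p * (2 * u) + p * u by ring.
  exact: lerD.
have -> : 4 * (a * b * p) * (p * (3 * u)) = 12 * (p ^+ (#|Y| + #|X| * #|Y| + 2) * u).
  by rewrite !exprD /a /b; ring.
rewrite -mulrA ler_pM2l //; apply: le_trans (hC0 N) _.
by apply: ler_wpM2l => //; rewrite lef_pV2 ?posrE ?ltr0n // ler_nat.
Qed.

Lemma rate_ge (A M N : nat) (c : 'I_M -> 'I_N -> X) (stop : seq Y -> bool) (d m : R) :
  (1 < M)%N -> delay Q star A c stop = d%:E -> 0 <= d -> d <= m -> rho * m <= ln M%:R ->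
  (rho%:E <= rate Q star A c stop)%E.
Proof.
move=> M1 dE d0 dm hm; rewrite /rate dE /=; case: eqP => [_|/eqP dn0]; first exact: leey.
have {}d0 : 0 < d by rewrite lt_neqAle eq_sym dn0.
rewrite lee_fin ler_pdivlMr //; have [rho0|rho0] := leP rho 0.
  apply: (@le_trans _ _ 0); first by rewrite mulr_le0_ge0 // ltW.
  by rewrite ln_ge0 // ler1n ltnW.
by apply: le_trans hm; rewrite ler_pM2l.
Qed.

Lemma asymptotic_code (A : nat -> nat) (eps r C2 : R) (N2 : nat) :
  0 < eps -> 0 < r -> r <= (t2 - 1) * lam -> (forall N, 0 < A N)%N ->
  (forall N, (A N)%:R * expR (- ((t1 + t2 - 1) * lam * N%:R)) <= 2 * expR (- (r * N%:R))) ->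
  (forall N, (N2 <= N)%N -> A N = 1%N \/
     exists2 pt : {ffun 'I_N -> X} -> R, codeword_law pt &
       (A N + N)%:R * miss Q (tstN N) pt ord_max <= C2) ->
  exists N0, forall N, (N0 <= N)%N ->
  exists M (c : 'I_M -> 'I_N -> X) (stop : seq Y -> bool) (dec : seq Y -> 'I_M),
    [/\ (2 <= M)%N, (rho%:E <= rate Q star (A N) c stop)%E &
        (p_err Q star (A N) c stop dec <= eps%:E)%E].
Proof.
move=> eps0 r0 rle A_gt0 hA hmiss.
have [beta [C1 [beta0 C1_ge0 [N1 h1]]]] := typical_window.
have [C4 C4_ge0 hwrong] := wrong_codeword_bound r0 rle.
pose C3 := `|C2| + 2 * C1.
have C3_ge0 : 0 <= C3 by rewrite addr_ge0 // mulr_ge0.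
have [N3 hN3] := nat_ge_real ((C3 + C4) / eps + (C1 + C3) / beta).
exists (maxn 1 (maxn N1 (maxn N2 N3))) => N.
rewrite !geq_max => /and4P[N_gt0 /h1[k [hk1 hk2]] /hmiss{}hmiss NN3].
have N0 : 0 < N%:R :> R by rewrite ltr0n.
have [pt hpt [k2 hk3]] : exists2 pt : {ffun 'I_N -> X} -> R, codeword_law pt &
    exists k2 : 'I_N.+1, (A N + N)%:R * miss Q (tstN N) pt k2 <= C3.
  case: hmiss => [A1|[pt hpt hm]]; last first.
    exists pt => //; exists ord_max; apply: le_trans hm _.
    by apply: le_trans (ler_norm _) _; rewrite lerDl mulr_ge0.
  (* For [A = 1] the horizon is at most [2 * N], so the typical window also serves as the fallback
     [k2]. *)
  exists (fun a => \prod_i P (a i)); first exact: iid_codeword_law.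
  exists k; rewrite A1; have hi := iid_codeword_law N.
  apply: (@le_trans _ _ ((2 * N%:R) * miss Q (tstN N) (fun a => \prod_i P (a i)) k)).
    apply: ler_wpM2r; first exact: miss_ge0.
    by rewrite -natrM ler_nat mul2n -addnn leq_add2r.
  rewrite -mulrA; apply: (@le_trans _ _ (2 * C1)); last by rewrite lerDr.
  by rewrite ler_pM2l // hk2.
have m1 := hk2 pt hpt.
have ms1 : 0 <= miss Q (tstN N) pt k by exact: miss_ge0.
have ms2 : 0 <= miss Q (tstN N) pt k2 by exact: miss_ge0.
(* Rounding strictly up gives [lam * N <= ln M] and [M >= 2], at the cost of a factor at most 2. *)
pose M := (Num.truncn (expR (lam * N%:R))).+1.
have E1 : 1 < expR (lam * N%:R) by rewrite expR_gt1 mulr_gt0.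
have M_gt : expR (lam * N%:R) < M%:R by rewrite truncnS_gt.
have M_le : M%:R <= 2 * expR (lam * N%:R).
  rewrite /M -natr1 mulr_natl mulr2n; apply: lerD; last exact: ltW.
  by rewrite truncn_le expR_ge0.
have M1 : (1 < M)%N by rewrite -(ltr_nat R); exact: lt_trans M_gt.
have miss2 : miss Q (tstN N) pt k2 <= C3 / N%:R.
  rewrite ler_pdivlMr // mulrC; apply: le_trans hk3.
  by rewrite ler_wpM2r // ler_nat leq_addl.
have [c [stop [dec [err [d [d0 dle dE]]]]]] :
    exists (c : 'I_M -> 'I_N -> X) (stop : seq Y -> bool) (dec : seq Y -> 'I_M),
    (p_err Q star (A N) c stop dec <= eps%:E)%E /\
    exists d : R, [/\ 0 <= d, d <= k%:R + beta * N%:R & delay Q star (A N) c stop = d%:E].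
  apply: (random_coding_test hpt (A_gt0 N) _ eps0 (k2 := k2)
    (T1 := t1 * lam * N%:R) (T2 := t2 * lam * N%:R)) => //; first exact: mulr_gt0.
  have := hwrong N (A N) M N_gt0 M_le (hA N) _ _ erefl erefl; move: (M%:R * _) => wr /= hwr.
  apply: (@le_trans _ _ ((C3 / N%:R + C4 / N%:R) / eps + (C1 + C3) / (beta * N%:R))).
    apply: lerD; (apply: ler_wpM2r; first by rewrite invr_ge0 ?mulr_ge0 // ltW).
      exact: lerD.
    exact: lerD.
  have -> : (C3 / N%:R + C4 / N%:R) / eps + (C1 + C3) / (beta * N%:R) =
      ((C3 + C4) / eps + (C1 + C3) / beta) / N%:R.
    by field; rewrite !gt_eqF.
  rewrite ler_pdivrMr // mul1r; apply: le_trans hN3 _; by rewrite ler_nat.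
exists M, c, stop, dec; split => //.
apply: (rate_ge M1 dE d0 dle); apply: le_trans hk1 _.
by rewrite -ler_expR lnK ?posrE ?ltr0n // ltW.
Qed.

End Rates.
End Achievability.

Lemma absz_ceil (R : realType) (x : R) : 0 < x ->
  [/\ (0 < `|Num.ceil x|)%N, (`|Num.ceil x|%N)%:R = (Num.ceil x)%:~R :> R &
      (`|Num.ceil x|%N)%:R <= x + 1].
Proof.
move=> x0; have c0 : 0 < Num.ceil x by rewrite ceil_gt0.
have e : (`|Num.ceil x|%N)%:R = (Num.ceil x)%:~R :> R.
  by rewrite natr_absz gtr0_norm.
split=> //; first by rewrite absz_gt0 gt_eqF.
by rewrite e -lerBlDr -[X in _ - X]/(1%:~R) -intrB ltW // ceilB1_lt.
Qed.

(** Both miss exponents at full length exceed [alpha] by a margin [r], which beats the horizon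
    [A + N] and all polynomial factors. *)
Lemma exponential_miss_bound (R : realType) (X Y : finType) (Q : X -> Y -> R) (star : X)
    (P : X -> R) (alpha t1 t2 lam delta ga gb : R) (A : nat -> nat) :
  is_chan Q -> is_dist P -> 0 < delta < 1 -> 0 <= alpha -> 0 <= lam -> 0 <= t1 -> 0 <= t2 ->
  alpha < ga -> alpha < gb ->
  (forall W, is_dist W -> (divKL W (Q star) < (t1 * lam / delta)%:E)%E ->
     (ga%:E <= divKL W (outm P Q))%E) ->
  (forall V, is_chan V -> mutinf (joint P V) <= t2 * lam / delta ->
     (gb%:E <= divKL (joint P V) (joint P Q))%E) ->
  (forall N, (A N)%:R <= expR (alpha * N%:R) + 1) ->
  exists C N0, forall N, (N0 <= N)%N ->
    exists2 pt : {ffun 'I_N -> X} -> R, codeword_law P pt &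
      (A N + N)%:R * miss Q (fun k => @test R X Y k P (Q star)
         (t1 * lam * N%:R) (t2 * lam * N%:R)) pt ord_max <= C.
Proof.
move=> hQ hP /andP[d0 d1] al0 lam0 t1_ge0 t2_ge0 aga agb ha hb hA.
have gb0 : 0 < gb by apply: le_lt_trans agb.
have rat1 : alpha / gb < 1 by rewrite ltr_pdivrMr // mul1r.
(* [w > delta] lets the threshold enlarged by [1 / delta] absorb the loss of [w] in the joint test,
   and [w > alpha / gb] keeps the exponent [w * gb] above [alpha]. *)
pose m := Num.max delta (alpha / gb); pose w := (m + 1) / 2.
have m1 : m < 1 by rewrite gt_max d1 rat1.
have w1 : w < 1 := (midf_lt m1).2.
have mw : m < w := (midf_lt m1).1.
have dw : delta < w by apply: le_lt_trans mw; rewrite le_max lexx.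
have aw : alpha < w * gb.
  by rewrite -ltr_pdivrMr //; apply: le_lt_trans mw; rewrite le_max lexx orbT.
have w0 : 0 < w := lt_trans d0 dw.
pose r := Num.min (ga - alpha) (w * gb - alpha).
have r0 : 0 < r by rewrite lt_min !subr_gt0 aga aw.
have rga : alpha + r <= ga by rewrite -lerBrDl ge_min lexx.
have rgb : alpha + r <= w * gb by rewrite -lerBrDl ge_min lexx orbT.
have [C0 C0_ge0 hC0] := poly_exp_bound (#|Y| + #|X| * #|Y| + 1) r0.
have w01 : 0 < w < 1 by rewrite w0 w1.
have [N1 hN1] := typical_codeword_law hP w01.
exists (6 * C0), (maxn 1 N1) => N; rewrite geq_max => /andP[N_gt0 /hN1[pt hpt ptyp]].
exists pt => //; rewrite miss_ord_max.
have N0 : 0 < N%:R :> R by rewrite ltr0n.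
have hT1 : t1 * lam * N%:R <= N%:R * (t1 * lam / delta).
  rewrite mulrC; apply: ler_wpM2l => //.
  by rewrite ler_peMr ?mulr_ge0 // invf_ge1 // ltW.
have hT2 : t2 * lam * N%:R <= w * N%:R * (t2 * lam / delta).
  have -> : w * N%:R * (t2 * lam / delta) = (w / delta) * (t2 * lam * N%:R) by ring.
  by rewrite ler_peMl ?mulr_ge0 // ler_pdivlMr // mul1r ltW.
have := test_miss_exponential hP hQ (hQ star).1 N_gt0 w0 hpt.1 hpt.2 ptyp hT1 hT2 ha hb.
set ms := \sum_a _ => hms.
pose p : R := N.+1%:R; pose a := p ^+ #|Y|; pose b := p ^+ (#|X| * #|Y|).
pose E := expR (alpha * N%:R); pose u := expR (- (r * N%:R)).
have p1 : 1 <= p by rewrite ler1n.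
have p0 : 0 <= p by apply: le_trans p1.
have a1 : 1 <= a by rewrite exprn_ege1.
have b1 : 1 <= b by rewrite exprn_ege1.
have a0 : 0 <= a by apply: le_trans a1.
have b0 : 0 <= b by apply: le_trans b1.
have E1 : 1 <= E by rewrite -expR0 ler_expR mulr_ge0.
have E0 : 0 < E by exact: expR_gt0.
have u0 : 0 <= u by exact: expR_ge0.
have expo_le (x y : R) : alpha + r <= x -> y = x * N%:R -> expR (- y) <= u / E.
  move=> hx ->; rewrite /u /E -expRN -expRD ler_expR -opprD lerN2.
  by rewrite [leLHS]addrC -mulrDl ler_wpM2r.
have ms_le : ms <= (3 * (a * b)) * (u / E).
  have ab_a : a <= a * b by rewrite ler_peMr.
  have ab_b : b <= a * b by rewrite ler_peMl.
  have uE : 0 <= u / E by rewrite divr_ge0 // ltW.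
  apply: le_trans hms _; rewrite !natrX -/p -/a -/b.
  have h1 : expR (- (N%:R * ga)) * a <= u / E * (a * b).
    by apply: ler_pM => //; apply: expo_le rga _; rewrite mulrC.
  have h2 : expR (- (w * N%:R * gb)) * b <= u / E * (a * b).
    by apply: ler_pM => //; apply: expo_le rgb _; rewrite mulrAC.
  have -> : 3 * (a * b) * (u / E) = 2 * (u / E * (a * b)) + u / E * (a * b) by ring.
  by apply: lerD => //; rewrite ler_pM2l.
have AN_le : (A N + N)%:R <= 2 * p * E.
  rewrite natrD; apply: (@le_trans _ _ (E + p)).
    by rewrite /p -natr1 [N%:R + 1]addrC addrA lerD2r; exact: hA.
  have -> : 2 * p * E = p * E + p * E by ring.
  by apply: lerD; [rewrite ler_peMl // ltW|rewrite ler_peMr].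
apply: (@le_trans _ _ (2 * p * E * ((3 * (a * b)) * (u / E)))).
  apply: ler_pM => //; rewrite /ms; apply: sumr_ge0 => x _.
  case/andP: (hpt.1 x) => ptx _; rewrite mulr_ge0 // sumr_ge0 // => z _.
  by rewrite mulr_ge0 // prodr_ge0 // => i _; exact: (hQ _).1.
have -> : 2 * p * E * ((3 * (a * b)) * (u / E)) = 6 * (p ^+ (#|Y| + #|X| * #|Y| + 1) * u).
  by rewrite !exprD /a /b expr1; field; rewrite gt_eqF.
rewrite ler_pM2l //; apply: le_trans (hC0 N) _.
by rewrite ler_pdivrMr ?ltr0n // ler_peMr // ler1n.
Qed.

Theorem theorem2 (R : realType) (X Y : finType) (Q : X -> Y -> R) (star : X)
  (HQ : is_chan Q)
  (Hout : forall y : Y, exists x : X, 0 < Q x y)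
  (Hcap : (0 < capacity Q)%E)
  (alpha t1 t2 delta : R) (P : X -> R)
  (Halpha : 0 <= alpha) (Ht1 : 0 <= t1) (Ht2 : 1 < t2)
  (HP : is_dist P) (HI : 0 < mutinf (joint P Q))
  (Hdelta : 0 < delta < 1)
  (Ha : (alpha%:E <
         ereal_inf [set divKL (outm P V) (outm P Q) |
                    V in [set V | is_chan V /\
                       (divKL (outm P V) (Q star)
                          < (t1 * alpha / (delta * (t1 + t2 - 1)))%:E)%E]])%E)
  (Hb : (alpha%:E <
         ereal_inf [set divKL (joint P V) (joint P Q) |
                    V in [set V | is_chan V /\
                       (mutinf (joint P V) <= t2 * alpha / (delta * (t1 + t2 - 1)))%R]])%E)
  (Hc : ((t1 / t2)%:E <
         divKL (outm P Q) (Q star) * ((mutinf (joint P Q))^-1)%:E)%E) :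
  achievable Q star alpha (mutinf (joint P Q) / t2).
Proof.
set I := mutinf _ in HI Hc *.
have t2_gt0 : 0 < t2 := lt_trans ltr01 Ht2.
have t21 : 0 < t2 - 1 by rewrite subr_gt0.
(* Condition (c) in finite form. It is stated for all [t <= t1] because the case [alpha = 0] uses
   [t = 0]. *)
have llr t : t <= t1 -> exists K, t / t2 * I <
    \sum_b outm P Q b * (if Q star b == 0 then K else ln (outm P Q b / Q star b)).
  move=> tt1; apply: ltedivKL_llr; first exact: outm_dist.
  apply: (@le_lt_trans _ _ (t1 / t2 * I)%:E).
    by rewrite lee_fin ler_pM2r // ler_pM2r // invr_gt0.
  move: Hc; case: (divKL _ _) => [x| |]; last by rewrite gt0_mulNye ?lte_fin ?invr_gt0.
    by rewrite -EFinM !lte_fin ltr_pdivlMr.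
  by move=> _; exact: ltry.
move=> eps eps0.
have rho_lt : (I / t2 - eps) * t2 < I.
  by rewrite mulrBl divfK ?gt_eqF // ltrBlDr ltrDl mulr_gt0.
pose A N := `|Num.ceil (expR ((alpha - eps) * N%:R))|%N.
have A_spec N := absz_ceil (expR_gt0 ((alpha - eps) * N%:R)).
have A_gt0 N : (0 < A N)%N by case: (A_spec N).
have A_le N : (A N)%:R <= expR ((alpha - eps) * N%:R) + 1 by case: (A_spec N).
suff [N0 hN0] : exists N0, forall N, (N0 <= N)%N ->
  exists M (c : 'I_M -> 'I_N -> X) (stop : seq Y -> bool) (dec : seq Y -> 'I_M),
    [/\ (2 <= M)%N, ((I / t2 - eps)%:E <= rate Q star (A N) c stop)%E &
        (p_err Q star (A N) c stop dec <= eps%:E)%E].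
  exists N0 => N /hN0[M [c [stop [dec [M2 hrate herr]]]]] _.
  by exists M, (A N), c, stop, dec; split => //; case: (A_spec N).
have [al0|al0] := leP alpha 0.
  (* Since then [alpha = 0], the start time is known ([A = 1]) and the output test is
     not needed: the rate [ln M / N] may be any positive constant below [I / t2]. *)
  have alE : alpha = 0 by apply/eqP; rewrite eq_le al0.
  have A1 N : A N = 1%N.
    rewrite /A alE sub0r mulNr; set x := expR _.
    suff -> : Num.ceil x = 1 by [].
    apply/eqP; rewrite eq_le ceil_le_int -gtz0_ge1 ceil_gt0 expR_gt0 andbT.
    by rewrite -[1%:~R]expR0 ler_expR oppr_le0 mulr_ge0 // ltW.
  pose lam := I / (2 * t2).
  have lam0 : 0 < lam by rewrite divr_gt0 // mulr_gt0.
  have lam_lt : lam * t2 < I.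
    have -> : lam * t2 = I / 2 by rewrite /lam; field; rewrite gt_eqF.
    by rewrite ltr_pdivrMr // ltr_pMr // ltr1n.
  have [K hK] := llr 0 Ht1.
  apply: (asymptotic_code HQ HP lam0 (lexx 0) Ht2 lam_lt hK rho_lt (r := (t2 - 1) * lam)
    (C2 := 0) (N2 := 0)) => //; first exact: mulr_gt0.
  - move=> N; rewrite A1 mul1r add0r ler_peMl ?expR_ge0 // ler1n //.
  - by move=> N _; left.
pose s := t1 + t2 - 1; pose lam := alpha / s.
have s0 : 0 < s by rewrite /s -addrA ltr_wpDl.
have lam0 : 0 < lam by rewrite divr_gt0.
have slam : s * lam = alpha by rewrite /lam mulrC divfK // gt_eqF.
have /andP[d0 d1] := Hdelta.
have thrE t : t * alpha / (delta * s) = t * lam / delta.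
  by rewrite /lam; field; rewrite !gt_eqF.
move: Ha Hb; rewrite -/s !thrE => /lt_ereal_inf_gap[ga aga ha] /lt_ereal_inf_gap[gb agb hb].
(* Constant channels realise every output law, so condition (a) extends to arbitrary [W]. *)
have {}ha W : is_dist W -> (divKL W (Q star) < (t1 * lam / delta)%:E)%E ->
    (ga%:E <= divKL W (outm P Q))%E.
  move=> hW lt; have WE : outm P (fun=> W) = W.
    by apply/funext => y; rewrite /outm -mulr_suml HP.2 mul1r.
  apply: ha; exists (fun=> W); last by rewrite WE.
  by split=> [x|]; [exact: hW|rewrite WE].
have {}hb V : is_chan V -> mutinf (joint P V) <= t2 * lam / delta ->
    (gb%:E <= divKL (joint P V) (joint P Q))%E.
  by move=> hV le; apply: hb; exists V.
(* The channel [Q] itself has divergence 0 in (b), so it must violate the information constraint;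
   this bounds [I] from below. *)
have lam_lt : lam * t2 < I.
  apply: (@lt_le_trans _ _ (t2 * lam / delta)).
    by rewrite [lam * t2]mulrC ltr_pdivlMr // gtr_pMr // mulr_gt0.
  rewrite leNgt; apply/negP => /ltW /(hb Q HQ).
  rewrite divKL_klE; last 2 first.
  - exact: (joint_dist HP HQ).1.
  - by move=> u; exact: lt0r_neq0.
  rewrite lee_fin kl_joint // big1 => [|a _].
    by rewrite leNgt (lt_trans al0 agb).
  rewrite /kl big1 ?mulr0 // => b _; have [->|q0] := eqVneq (Q a b) 0; first by rewrite mul0r.
  by rewrite divff // ln1 mulr0.
have [K hK] := llr t1 (lexx t1).
have A_le2 N : expR ((alpha - eps) * N%:R) + 1 <= expR (alpha * N%:R) + 1.
  by rewrite lerD2r ler_expR ler_wpM2r // gerBl ltW.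
have [C2 [N2 hC2]] := @exponential_miss_bound _ _ _ Q star P alpha t1 t2 lam delta ga gb A
  HQ HP Hdelta Halpha (ltW lam0) Ht1 (ltW t2_gt0) aga agb ha hb
  (fun N => le_trans (A_le N) (A_le2 N)).
(* [eps] is the exponent left for false alarms in pure noise, [(t2 - 1) * lam] that for windows
   overlapping the codeword. The latter is at most [alpha], so [r] also covers the rounding of
   [A]. *)
pose r := Num.min eps ((t2 - 1) * lam).
have r_eps : r <= eps by rewrite ge_min lexx.
have r_t2 : r <= (t2 - 1) * lam by rewrite ge_min lexx orbT.
have r0 : 0 < r by rewrite lt_min eps0 mulr_gt0.
apply: (asymptotic_code HQ HP lam0 Ht1 Ht2 lam_lt hK rho_lt (r := r)
  (C2 := C2) (N2 := N2)) => //; last by move=> N /hC2; right.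
move=> N; rewrite -/s slam.
apply: (@le_trans _ _ ((expR ((alpha - eps) * N%:R) + 1) * expR (- (alpha * N%:R)))).
  by apply: ler_wpM2r => //; exact: expR_ge0.
rewrite mulrDl mul1r -expRD [leRHS]mulr_natl mulr2n; apply: lerD; rewrite ler_expR.
  have -> : (alpha - eps) * N%:R + - (alpha * N%:R) = - (eps * N%:R) by ring.
  by rewrite lerN2 ler_wpM2r.
rewrite lerN2 ler_wpM2r //; apply: le_trans r_t2 _.
by rewrite -slam ler_wpM2r ?(ltW lam0) // /s lerD2r lerDr.
Qed.
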